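(* For every $K\in\mathcal{K}_0^n$ and every $0\le i\le n$ we have $$W_{n-i}^{\clubsuit}(K)=\frac{\left|B_2^n\right|}{\left|B_2^i\right|}\cdot\int_{G(n,i)}\left|\left(\operatorname{Proj}_E K\right)^{\clubsuit}\right|\mathrm{d}\mu(E),$$ where $\mu$ is the Haar probability measure on $G(n,i)$ and the flower map $\clubsuit$ on the right hand side is taken inside the subspace $E$.
   Context: A convex body in $\mathbb{R}^n$ is a closed convex set $K\subseteq\mathbb{R}^n$ with $0\in K$ (not assumed compact, nor with non-empty interior); $\mathcal{K}_0^n$ is the set of all convex bodies. The support function of $K$ is $h_K:S^{n-1}\to[0,\infty]$, $h_K(\theta)=\sup_{x\in K}\langle x,\theta\rangle$. A star set is a non-empty $A\subseteq\mathbb{R}^n$ such that $x\in A$ and $0\le\lambda\le1$ imply $\lambda x\in A$; its radial function is $r_A(\theta)=\sup\{\lambda\ge0:\lambda\theta\in A\}\in[0,\infty]$. A star body is a star set $A$ with $r_A(\theta)\theta\in A$ for all $\theta\in S^{n-1}$ with $r_A(\theta)<\infty$; it is uniquely determined by $r_A$. For $K\in\mathcal{K}_0^n$, the flower $K^{\clubsuit}$ is the star body with radial function $r_{K^{\clubsuit}}=h_K$; inside a subspace $E$ the same definition is used with $E$ and $S^{n-1}\cap E$ in place of $\mathbb{R}^n$ and $S^{n-1}$. $G(n,i)$ is the set of all $i$-dimensional linear subspaces of $\mathbb{R}^n$; $\operatorname{Proj}_E$ is orthogonal projection onto $E$; $|\cdot|$ is volume in the appropriate dimension ($i$-dimensional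 volume in $E\in G(n,i)$); $B_2^m$ is the unit Euclidean ball of $\mathbb{R}^m$; $\sigma$ is the uniform probability measure on $S^{n-1}$. Put $V^{\clubsuit}(K_1,\ldots,K_n)=\left|B_2^n\right|\cdot\int_{S^{n-1}}h_{K_1}(\theta)\cdots h_{K_n}(\theta)\,\mathrm{d}\sigma(\theta)$ and $W_i^{\clubsuit}(K)=V^{\clubsuit}(\underbrace{K,\ldots,K}_{n-i},\underbrace{B_2^n,\ldots,B_2^n}_{i})$. *)

(* Defs.v *)
(* R^n is the type 'rV[R]_n of row vectors. *)
From HB Require Import structures.
From mathcomp Require Import all_boot all_order all_algebra.
From mathcomp Require Import all_classical all_reals all_analysis.

Set Implicit Arguments.
Unset Strict Implicit.
Unset Printing Implicit Defensive.

Import Order.TTheory GRing.Theory Num.Theory.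
Import numFieldNormedType.Exports.

Local Open Scope classical_set_scope.
Local Open Scope ring_scope.

Section Bodies.
Context {R : realType} {n : nat}.
Implicit Types (x y z u v theta : 'rV[R]_n) (K A : set 'rV[R]_n).
Implicit Types (E : {vspace 'rV[R]_n}).

Definition dotp u v : R := \sum_(j < n) u 0 j * v 0 j.

Definition convex_body K : Prop :=
  [/\ closed K, convex_set (K : set (convex_lmodType 'rV[R]_n)) & K 0].

(* Nonnegative as soon as 0 belongs to K. *)
Definition support_fun K theta : \bar R :=
  ereal_sup [set (dotp x theta)%:E | x in K].

Definition radial_fun A theta : \bar R :=
  ereal_sup [set l%:E | l in [set l : R | 0 <= l /\ A (l *: theta)]].

Definition star_set E A : Prop :=
  [/\ A !=set0, A `<=` [set` E] &
      forall x (l : R), A x -> 0 <= l <= 1 -> A (l *: x)].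

Definition star_body E A : Prop :=
  star_set E A /\
  forall theta, dotp theta theta = 1 -> theta \in E ->
    (radial_fun A theta < +oo)%E -> A (fine (radial_fun A theta) *: theta).

(* The flower of K taken inside E. A star body of E is determined by its radial
   function, so that the choice made by xget is unique. K need not be closed:
   this matters for projections of unbounded bodies. *)
Definition flower E K : set 'rV[R]_n :=
  xget set0 [set A | star_body E A /\
    forall theta, dotp theta theta = 1 -> theta \in E ->
      radial_fun A theta = support_fun K theta].

(* Orthogonal projection: the unique y in E such that x - y is orthogonal to E. *)
Definition oproj E x : 'rV[R]_n :=
  xget 0 [set y | y \in E /\ forall z, z \in E -> dotp (x - y) z = 0].

End Bodies.

Definition sphere (R : realType) (n : nat) : set 'rV[R]_n :=
  [set x | dotp x x = 1].

Definition eball (R : realType) (n : nat) : set 'rV[R]_n :=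
  [set x | dotp x x <= 1].

Arguments sphere R n : clear implicits.
Arguments eball R n : clear implicits.

Section Volume.
Context {R : realType}.

Definition consR n (p : n.-tuple R * R) : n.+1.-tuple R :=
  [the n.+1.-tuple R of p.2 :: p.1].

Lemma measurable_consR n : measurable_fun [set: n.-tuple R * R] (@consR n).
Proof. exact: measurable_cons. Qed.

Section lebesgue_step.
Context n (mu : {measure set (n.-tuple R) -> \bar R}).

Definition lebesgue_step : set (n.+1.-tuple R) -> \bar R :=
  pushforward (mu \x lebesgue_measure)%E (@consR n).

Let mf := @measurable_consR n.

Let lebesgue_step0 : lebesgue_step set0 = 0%E.
Proof. exact: measure0. Qed.

Let lebesgue_step_ge0 A : (0 <= lebesgue_step A)%E.
Proof. exact: measure_ge0. Qed.

Let lebesgue_step_sigma_additive : semi_sigma_additive lebesgue_step.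
Proof. exact: measure_semi_sigma_additive. Qed.

HB.instance Definition _ := isMeasure.Build _ _ _ lebesgue_step
  lebesgue_step0 lebesgue_step_ge0 lebesgue_step_sigma_additive.

End lebesgue_step.

(* n-dimensional Lebesgue measure on the Borel sets of R^n, as an iterated
   product of the one-dimensional one. *)
Fixpoint lebesgue_tuple n : {measure set (n.-tuple R) -> \bar R} :=
  if n is m.+1 then lebesgue_step (lebesgue_tuple m) else \d_ [tuple].

Definition volume n (A : set 'rV[R]_n) : \bar R :=
  lebesgue_tuple n [set t : n.-tuple R | A (\row_j tnth t j)].

(* A matrix whose rows form an orthonormal basis of E. *)
Definition onb n (E : {vspace 'rV[R]_n}) : 'M[R]_(\dim E, n) :=
  xget 0 [set U | U *m U^T = 1%:M /\ forall x, (x \in E) = (x <= U)%MS].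

(* The (\dim E)-dimensional volume in E: Lebesgue measure transported by the
   linear isometry c |-> c *m onb E from R^(\dim E) to E; it does not depend on
   the orthonormal basis. *)
Definition volume_in n (E : {vspace 'rV[R]_n}) (A : set 'rV[R]_n) : \bar R :=
  volume [set c : 'rV[R]_(\dim E) | A (c *m onb E)].

End Volume.

Definition borel_mx (R : realType) (m n : nat) :=
  g_sigma_algebraType (@open 'M[R]_(m, n)).

Section Grassmannian.
Context {R : realType} {n : nat}.

HB.instance Definition _ := isPointed.Build {vspace 'rV[R]_n} 0%VS.

Definition proj_matrix (E : {vspace 'rV[R]_n}) : borel_mx R n n :=
  lin1_mx (oproj E).

(* All linear subspaces of R^n, with the Borel sigma-algebra of the topology
   that identifies E with the matrix of the orthogonal projection onto E. *)
Definition subspaces := g_sigma_algebra_preimageType proj_matrix.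

Definition grassmannian (i : nat) : set subspaces :=
  [set E : {vspace 'rV[R]_n} | \dim E = i].

Definition rotate (Q : 'M[R]_n) (E : subspaces) : subspaces :=
  (linfun (mulmxr Q : 'rV[R]_n -> 'rV[R]_n) @: (E : {vspace 'rV[R]_n}))%VS.

Definition orthogonal_mx (Q : 'M[R]_n) : Prop := Q *m Q^T = 1%:M.

(* The Haar probability measure on G(n, i): the Borel probability measure
   carried by G(n, i) and invariant under the action of O(n). *)
Definition haar_grassmannian (i : nat) (mu : probability subspaces R) : Prop :=
  mu (grassmannian i) = 1%E /\
  forall Q, orthogonal_mx Q ->
  forall A : set subspaces, measurable A -> mu (rotate Q @^-1` A) = mu A.

(* The uniform probability measure on the sphere: the Borel probability measure
   on R^n carried by the sphere and invariant under the action of O(n). *)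
Definition uniform_sphere (sigma : probability (borel_mx R 1 n) R) : Prop :=
  sigma (sphere R n) = 1%E /\
  forall Q, orthogonal_mx Q ->
  forall A : set (borel_mx R 1 n), measurable A ->
    sigma ((fun x : borel_mx R 1 n => (x : 'rV[R]_n) *m Q) @^-1` A) = sigma A.

End Grassmannian.
Arguments subspaces R n : clear implicits.
Arguments grassmannian R n i : clear implicits.

Section MixedVolume.
Context {R : realType} {n : nat} (sigma : probability (borel_mx R 1 n) R).

(* Products are taken in the extended reals, with 0 * +oo = 0. *)
Definition flower_mixed_volume (K : 'I_n -> set 'rV[R]_n) : \bar R :=
  (volume (eball R n) *
   \int[sigma]_(theta in sphere R n)
     \prod_(j < n) support_fun (K j) theta)%E.

Definition flower_quermassintegral (i : nat) (K : set 'rV[R]_n) : \bar R :=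
  flower_mixed_volume (fun j => if (j < n - i)%N then K else eball R n).

End MixedVolume.

(* Main.v *)
(* Up to the constant |B^i|/|B^n|, the volume of the flower of Proj_E K in E is
   the average over the unit ball of R^n of h_K(Proj_E x / |Proj_E x|)^i: by
   polar coordinates in E the volume is the integral of h_K^i for the cone
   measure of the unit sphere of E, and the law of Proj_E x / |Proj_E x| is, like
   the cone measure, invariant under the rotations of E. Averaging over E as
   well, the law of Proj_E x / |Proj_E x| becomes an O(n)-invariant measure on
   the unit sphere of R^n, hence a multiple of sigma. Both steps rest on the
   uniqueness, up to a factor, of rotation-invariant measures on a sphere. *)
Require Import Defs.
From HB Require Import structures.
From mathcomp Require Import all_boot all_order all_algebra.
From mathcomp Require Import all_classical all_reals all_analysis.
From mathcomp Require Import measurable_realfun ring lra.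
Set Implicit Arguments.
Unset Strict Implicit.
Unset Printing Implicit Defensive.
Import Order.TTheory GRing.Theory Num.Theory.
Import numFieldNormedType.Exports.
Local Open Scope classical_set_scope.
Local Open Scope ring_scope.

(** * Vectors and Borel measurability *)

(** The basis [onb E] is a mere choice and carries no measurability in E. This is why the flower
    volume is rewritten over the ball of the ambient space: there E enters only through its
    projection matrix, which is measurable by the very definition of [subspaces], and Tonelli
    applies in the pair (E, x). No law is normalised. Those obtained from balls keep the masses
    |B_2^n| and |B_2^i|, and uniqueness is stated with total masses as cross factors, so the
    constants of the formula appear by themselves. Uniqueness is obtained by double counting: on the
    sphere all balls of a given radius have the same mass for an invariant measure, and Tonelli on
    pairs of close points compares two such measures, first on balls, then on open sets. Support
    functions may be infinite, so all identities live in the extended reals and are cancelled only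
    by ball volumes, which are positive and finite. Dimension 0 is treated apart: the sphere of R^0
    is empty and the direction of a zero projection is a default value. *)

Lemma ballR (R : realType) (x e : R) : ball x e = [set y | `|x - y| < e].
Proof. by []. Qed.

(** Coordinates suffice because every open set of matrices is a countable union of boxes with
    rational centres and radii 1/(k+1). *)
Lemma measurable_matrixP d (T : measurableType d) (R : realType) (m n : nat)
    (g : T -> borel_mx R m n) :
  measurable_fun setT g <->
  forall i j, measurable_fun setT (fun t => (g t : 'M[R]_(m, n)) i j).
Proof.
have coordm i j : measurable_fun setT (fun A : borel_mx R m n => (A : 'M[R]_(m, n)) i j).
  apply: (measurability _ (measurable_realfun.RGenOpens.measurableE R)).
  move=> _ [_ [a [b ->] <-]]; rewrite setTI; apply: sub_sigma_algebra.
  by apply: open_comp => [x _|]; [exact: coord_continuous|exact: interval_open].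
split=> [mg i j|mg]; first exact: measurableT_comp (coordm i j) mg.
apply: (@measurability _ _ T (borel_mx R m n) setT g (@open 'M[R]_(m, n)) erefl).
move=> _ [U oU <-]; rewrite setTI.
pose box (p : 'M[rat]_(m, n) * nat) : set 'M[R]_(m, n) :=
  [set N | forall i j, `|N i j - ratr (p.1 i j)| < p.2.+1%:R^-1].
have -> : g @^-1` U = \bigcup_p if `[< box p `<=` U >] then g @^-1` box p else set0.
  apply/seteqP; split=> [t Ut|t [p _]]; last by case: asboolP => // sub /sub.
  have /nbhs_ballP[e /= e0 eU] : nbhs (g t : 'M[R]_(m, n)) U.
    exact: open_nbhs_nbhs.
  (* Half of e: [g t] and any other point of the box are both within 1/(k+1) of its centre. *)
  have [k ke] : exists k : nat, k.+1%:R^-1 < e / 2.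
    have [k _ /(_ k (leqnn _))] := near_infty_natSinv_lt (PosNum (divr_gt0 e0 (ltr0n R 2))).
    by exists k.
  have /choice[q hq] : forall ij : 'I_m * 'I_n, exists r : rat,
      `|(g t : 'M[R]_(m, n)) ij.1 ij.2 - ratr r| < k.+1%:R^-1.
    move=> ij; set x := _ ij.1 ij.2.
    have /rat_in_itvoo[r] : x - k.+1%:R^-1 < x + k.+1%:R^-1.
      by rewrite ltrBlDr -addrA ltrDl addr_gt0// invr_gt0.
    by rewrite in_itv/= -ltr_distl distrC; exists r.
  exists (\matrix_(i, j) q (i, j), k) => //.
  have bt : box (\matrix_(i, j) q (i, j), k) (g t).
    by move=> i j /=; rewrite mxE; exact: (hq (i, j)).
  rewrite ifT//; apply/asboolP => N bN; apply: eU; split => // i j.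
  rewrite ballR/= [e]splitr -(subrKA (ratr (q (i, j)))).
  rewrite (le_lt_trans (ler_normD _ _))// ltrD//.
    by have := bt i j; rewrite /= mxE => /lt_trans; apply.
  by have := bN i j; rewrite /= mxE distrC => /lt_trans; apply.
apply: countable_bigcupT_measurable => // p.
case: asboolP => // _.
have -> : g @^-1` box p = \bigcap_(ij in [set: 'I_m * 'I_n])
    [set t | `|(g t : 'M[R]_(m, n)) ij.1 ij.2 - ratr (p.1 ij.1 ij.2)| < p.2.+1%:R^-1].
  apply/seteqP; split=> [t bt [i j] _|t bt i j]; first exact: bt.
  exact: (bt (i, j)).
apply: fin_bigcap_measurable; first exact: finite_finset.
move=> [i j] _ /=.
rewrite -[X in measurable X]setTI.
rewrite (_ : [set t | _] = (fun t => `|(g t : 'M[R]_(m, n)) i j - ratr (p.1 i j)|) @^-1`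
   [set` `]-oo, p.2.+1%:R^-1[]).
  apply: (measurableT_comp (@normr_measurable R setT)) => //.
  exact: measurable_funB.
by apply/seteqP; split => t /=; rewrite in_itv.
Qed.

Section vectors.
Context {R : realType}.
Implicit Types (m n k : nat).

Lemma measurable_dotp d (T : measurableType d) n (f g : T -> borel_mx R 1 n) :
  measurable_fun setT f -> measurable_fun setT g ->
  measurable_fun setT (fun t => dotp (f t) (g t)).
Proof.
move=> /measurable_matrixP mf /measurable_matrixP mg.
by apply: measurable_sum => j; exact: measurable_funM.
Qed.

Lemma measurable_mulmx d (T : measurableType d) m n k (f : T -> borel_mx R m n)
    (g : T -> borel_mx R n k) :
  measurable_fun setT f -> measurable_fun setT g ->
  measurable_fun setT
    (fun t => (f t : 'M[R]_(m, n)) *m (g t : 'M[R]_(n, k)) : borel_mx R m k).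
Proof.
move=> /measurable_matrixP mf /measurable_matrixP mg.
apply/measurable_matrixP => i j.
under eq_fun do rewrite mxE.
by apply: measurable_sum => l; exact: measurable_funM.
Qed.

Lemma measurable_addmx d (T : measurableType d) m n (f g : T -> borel_mx R m n) :
  measurable_fun setT f -> measurable_fun setT g ->
  measurable_fun setT
    (fun t => (f t : 'M[R]_(m, n)) + (g t : 'M[R]_(m, n)) : borel_mx R m n).
Proof.
move=> /measurable_matrixP mf /measurable_matrixP mg.
apply/measurable_matrixP => i j.
under eq_fun do rewrite mxE.
exact: measurable_funD.
Qed.

Lemma measurable_scalemx d (T : measurableType d) m n (a : T -> R)
    (f : T -> borel_mx R m n) :
  measurable_fun setT a -> measurable_fun setT f ->
  measurable_fun setT (fun t => a t *: (f t : 'M[R]_(m, n)) : borel_mx R m n).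
Proof.
move=> ma /measurable_matrixP mf.
apply/measurable_matrixP => i j.
under eq_fun do rewrite mxE.
exact: measurable_funM.
Qed.

Lemma dotpC n (x y : 'rV[R]_n) : dotp x y = dotp y x.
Proof. by apply: eq_bigr => j _; rewrite mulrC. Qed.

Lemma dotpE n (x y : 'rV[R]_n) : dotp x y = (x *m y^T) 0 0.
Proof. by rewrite mxE; apply: eq_bigr => j _; rewrite mxE. Qed.

Lemma dotpDl n (x y z : 'rV[R]_n) : dotp (x + y) z = dotp x z + dotp y z.
Proof. by rewrite !dotpE mulmxDl mxE. Qed.

Lemma dotpDr n (x y z : 'rV[R]_n) : dotp z (x + y) = dotp z x + dotp z y.
Proof. by rewrite dotpC dotpDl ![dotp z _]dotpC. Qed.

Lemma dotpZl n a (x y : 'rV[R]_n) : dotp (a *: x) y = a * dotp x y.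
Proof. by rewrite !dotpE -scalemxAl mxE. Qed.

Lemma dotpZr n a (x y : 'rV[R]_n) : dotp x (a *: y) = a * dotp x y.
Proof. by rewrite dotpC dotpZl dotpC. Qed.

Lemma dotpNl n (x y : 'rV[R]_n) : dotp (- x) y = - dotp x y.
Proof. by rewrite -scaleN1r dotpZl mulN1r. Qed.

Lemma dotpNr n (x y : 'rV[R]_n) : dotp x (- y) = - dotp x y.
Proof. by rewrite dotpC dotpNl dotpC. Qed.

Lemma dotp0l n (x : 'rV[R]_n) : dotp 0 x = 0.
Proof. by rewrite -(scale0r 0) dotpZl mul0r. Qed.

Lemma dotp_ge0 n (x : 'rV[R]_n) : 0 <= dotp x x.
Proof. by apply: sumr_ge0 => j _; rewrite -expr2 sqr_ge0. Qed.

Lemma dotp_coord n (x : 'rV[R]_n) j : x 0 j ^+ 2 <= dotp x x.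
Proof.
rewrite /dotp (bigD1 j)//= -expr2 lerDl sumr_ge0// => k _.
by rewrite -expr2 sqr_ge0.
Qed.

Lemma dotp_eq0 n (x : 'rV[R]_n) : (dotp x x == 0) = (x == 0).
Proof.
apply/eqP/eqP => [x0|->]; last exact: dotp0l.
apply/rowP => j; apply/eqP; rewrite mxE -sqrf_eq0 eq_le sqr_ge0 andbT -x0.
exact: dotp_coord.
Qed.

Lemma dotp_mulmx m n (x : 'rV[R]_m) (y : 'rV[R]_n) (A : 'M[R]_(m, n)) :
  dotp (x *m A) y = dotp x (y *m A^T).
Proof. by rewrite !dotpE trmx_mul trmxK mulmxA. Qed.

Lemma dotp_isometry m n (U : 'M[R]_(m, n)) (x y : 'rV[R]_m) :
  U *m U^T = 1%:M -> dotp (x *m U) (y *m U) = dotp x y.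
Proof. by move=> UU; rewrite dotp_mulmx -mulmxA UU mulmx1. Qed.

Lemma orthogonal_mx_tr n (Q : 'M[R]_n) : orthogonal_mx Q -> orthogonal_mx Q^T.
Proof. by rewrite /orthogonal_mx trmxK => /mulmx1C. Qed.

Lemma orthogonal_mxK n (Q : 'M[R]_n) : orthogonal_mx Q ->
  cancel (mulmx^~ Q : 'rV_n -> 'rV_n) (mulmx^~ Q^T).
Proof. by move=> oQ x; rewrite -mulmxA oQ mulmx1. Qed.

Lemma orthogonal_mxVK n (Q : 'M[R]_n) : orthogonal_mx Q ->
  cancel (mulmx^~ Q^T : 'rV_n -> 'rV_n) (mulmx^~ Q).
Proof. by move=> /orthogonal_mx_tr/orthogonal_mxK; rewrite trmxK. Qed.

Definition enorm n (x : 'rV[R]_n) : R := Num.sqrt (dotp x x).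

(** At 0 the inverse of the norm is 0, hence [unitv 0 = 0], a point off the sphere; in positive
    dimension it is discarded by null-set arguments. *)
Definition unitv n (x : 'rV[R]_n) : 'rV[R]_n := (enorm x)^-1 *: x.

Lemma enorm_ge0 n (x : 'rV[R]_n) : 0 <= enorm x.
Proof. exact: sqrtr_ge0. Qed.

Lemma enorm_sqr n (x : 'rV[R]_n) : enorm x ^+ 2 = dotp x x.
Proof. by rewrite sqr_sqrtr// dotp_ge0. Qed.

Lemma enorm_eq0 n (x : 'rV[R]_n) : (enorm x == 0) = (x == 0).
Proof. by rewrite -sqrf_eq0 enorm_sqr dotp_eq0. Qed.

Lemma enorm_gt0 n (x : 'rV[R]_n) : (0 < enorm x) = (x != 0).
Proof. by rewrite lt0r enorm_eq0 enorm_ge0 andbT. Qed.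

Lemma enorm0 n : enorm (0 : 'rV[R]_n) = 0.
Proof. by apply/eqP; rewrite enorm_eq0. Qed.

Lemma unitv0 n : unitv (0 : 'rV[R]_n) = 0.
Proof. by rewrite /unitv scaler0. Qed.

Lemma enormZ n a (x : 'rV[R]_n) : 0 <= a -> enorm (a *: x) = a * enorm x.
Proof.
by move=> a0; rewrite /enorm dotpZl dotpZr mulrA -expr2 sqrtrM ?sqr_ge0// sqrtr_sqr ger0_norm.
Qed.

Lemma enorm_le n (x : 'rV[R]_n) a : 0 <= a -> (enorm x <= a) = (dotp x x <= a ^+ 2).
Proof. by move=> a0; rewrite -enorm_sqr ler_sqr ?nnegrE ?enorm_ge0. Qed.

Lemma unitvZ n a (x : 'rV[R]_n) : 0 < a -> unitv (a *: x) = unitv x.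
Proof.
move=> a0; rewrite /unitv enormZ ?ltW// scalerA invfM mulrAC mulVf ?gt_eqF//.
by rewrite mul1r.
Qed.

Lemma enorm_unitvE n (x : 'rV[R]_n) : x = enorm x *: unitv x.
Proof.
have [->|x0] := eqVneq x 0; first by rewrite unitv0 scaler0.
by rewrite /unitv scalerA divff ?scale1r// enorm_eq0.
Qed.

Lemma enorm_isometry m n (U : 'M[R]_(m, n)) (x : 'rV[R]_m) :
  U *m U^T = 1%:M -> enorm (x *m U) = enorm x.
Proof. by move=> UU; rewrite /enorm dotp_isometry. Qed.

Lemma unitv_isometry m n (U : 'M[R]_(m, n)) (x : 'rV[R]_m) :
  U *m U^T = 1%:M -> unitv (x *m U) = unitv x *m U.
Proof. by move=> UU; rewrite /unitv enorm_isometry// scalemxAl. Qed.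

Lemma sphere_unitv n (x : 'rV[R]_n) : x != 0 -> sphere R n (unitv x).
Proof.
move=> x0; rewrite /sphere/= /unitv dotpZl dotpZr mulrA -enorm_sqr -invfM -expr2.
by rewrite mulVf// sqrf_eq0 enorm_eq0.
Qed.

Lemma measurable_enorm n : measurable_fun setT (@enorm n : borel_mx R 1 n -> R).
Proof.
apply: measurableT_comp; last exact: measurable_dotp.
by apply: continuous_measurable_fun; exact: sqrt_continuous.
Qed.

Lemma measurable_unitv n :
  measurable_fun setT (@unitv n : borel_mx R 1 n -> borel_mx R 1 n).
Proof.
apply: measurable_scalemx => //.
(* As a real power, the inverse of the norm is measurable across 0 too, where both expressions are
   0. *)
rewrite (_ : (fun t => _) = (fun x : borel_mx R 1 n => (enorm x) `^ (- 1))).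
  apply: (measurableT_comp (measurable_powR _)).
  exact: measurable_enorm.
by apply/funext => x; rewrite powR_inv1// enorm_ge0.
Qed.

Lemma open_measurable_borel m n (U : set 'M[R]_(m, n)) :
  open U -> measurable (U : set (borel_mx R m n)).
Proof. exact: sub_sigma_algebra. Qed.

Lemma measurable_sphere n : measurable (sphere R n : set (borel_mx R 1 n)).
Proof.
rewrite -[X in measurable X]setTI (_ : sphere R n =
  (fun x : borel_mx R 1 n => dotp x x) @^-1` [set 1])//.
by apply: measurable_dotp => //; exact: measurable_set1.
Qed.

Lemma measurable_eball n : measurable (eball R n : set (borel_mx R 1 n)).
Proof.
rewrite -[X in measurable X]setTI (_ : eball R n =
  (fun x : borel_mx R 1 n => dotp x x) @^-1` [set` `]-oo, 1]]).
  by apply: measurable_dotp => //; exact: measurable_itv.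
by apply/seteqP; split => x /=; rewrite in_itv.
Qed.

End vectors.

(** * Lebesgue measure on R^n *)

Section pushm.
Context d d' (T1 : measurableType d) (T2 : measurableType d') (R : realType).
Context (m : {measure set T1 -> \bar R}) (f : T1 -> T2).
Context (mf : measurable_fun setT f).

(* The proof mf is an argument so that the measure instances can be inferred. *)
Definition pushm of measurable_fun setT f : set T2 -> \bar R := pushforward m f.

Let pushm0 : pushm mf set0 = 0%E.
Proof. by rewrite /pushm /pushforward preimage_set0 measure0. Qed.

Let pushm_ge0 A : (0 <= pushm mf A)%E.
Proof. exact: measure_ge0. Qed.

Let pushm_sigma_additive : semi_sigma_additive (pushm mf).
Proof.
move=> F mF tF mUF; rewrite /pushm /pushforward preimage_bigcup.
apply: measure_semi_sigma_additive.
- by move=> n; rewrite -[X in measurable X]setTI; exact: mf.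
- apply/trivIsetP => /= i j _ _ ij; rewrite -preimage_setI.
  by move/trivIsetP : tF => /(_ _ _ _ _ ij) ->//; rewrite preimage_set0.
- by rewrite -preimage_bigcup -[X in measurable X]setTI; exact: mf.
Qed.

HB.instance Definition _ := isMeasure.Build _ _ _
  (pushm mf) pushm0 pushm_ge0 pushm_sigma_additive.

Lemma integral_pushm (D : set T2) (h : T2 -> \bar R) : measurable D ->
  measurable_fun D h -> (forall y, D y -> (0 <= h y)%E) ->
  (\int[pushm mf]_(y in D) h y = \int[m]_(x in f @^-1` D) h (f x))%E.
Proof.
by move=> mD mh h0; apply: ge0_integral_pushforward => // y /set_mem/h0.
Qed.

End pushm.

Section pushm_finite.
Context d d' (T1 : measurableType d) (T2 : measurableType d') (R : realType).
Context (m : {finite_measure set T1 -> \bar R}) (f : T1 -> T2).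
Context (mf : measurable_fun setT f).

Let pushm_fin : fin_num_fun (pushm m mf).
Proof.
move=> A mA; apply: fin_num_measure.
by rewrite -[X in measurable X]setTI; exact: mf.
Qed.

HB.instance Definition _ := Measure_isFinite.Build _ _ _ (pushm m mf) pushm_fin.

End pushm_finite.

Section lebesgue.
Context {R : realType}.

Lemma mule_pinjr (c : \bar R) : c \is a fin_num -> (0 < c)%E ->
  injective (fun x => x * c)%E.
Proof.
move=> cf c0 x y /= xy; have h := lee_pmul2r cf c0.
by apply/le_anti/andP; split; [rewrite -(h x y) xy|rewrite -(h y x) xy].
Qed.

(** The image of Lebesgue measure under s |-> a s + b, multiplied by a, gives every interval its
    length, so it is Lebesgue measure. *)
Lemma lebesgue_measure_affine (a b : R) (A : set R) : 0 < a -> measurable A ->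
  (lebesgue_measure [set s | A (a * s + b)%R] = a^-1%:E * lebesgue_measure A)%E.
Proof.
move=> a0 mA.
have mf : measurable_fun setT (fun s : measurableTypeR R => a * s + b : measurableTypeR R).
  by apply: measurable_funD => //; exact: measurable_funM.
pose k : {nonneg R} := NngNum (ltW a0).
suff -> : lebesgue_measure A = mscale k (pushm lebesgue_measure mf) A.
  rewrite /mscale/= /pushm /pushforward muleA -EFinM mulVf ?gt_eqF// mul1e//.
have H := @lebesgue_measure_unique R (mscale k (pushm lebesgue_measure mf)).
apply: H => //.
move=> X [[x y] _ <-] /=; rewrite /mscale/= /pushm /pushforward/=.
rewrite (_ : _ @^-1` _ = `](x - b) / a, (y - b) / a]%classic); last first.
  apply/seteqP; split => s /=; rewrite !in_itv/=.
    by rewrite ltr_pdivrMr// ler_pdivlMr// ltrBlDr lerBrDr ![s * a]mulrC.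
  by rewrite ltr_pdivrMr// ler_pdivlMr// ltrBlDr lerBrDr ![s * a]mulrC.
rewrite !lebesgue_measure_itv/= !lte_fin ltr_pM2r ?invr_gt0// ltrD2r.
case: ifPn => _; last by rewrite mule0.
by rewrite -!EFinB -EFinM; congr (_%:E); field; rewrite gt_eqF.
Qed.

Definition tuple_affine n (a : R) (b t : n.-tuple R) : n.-tuple R :=
  [tuple a * tnth t j + tnth b j | j < n].

Lemma measurable_tuple_affine n a (b : n.-tuple R) :
  measurable_fun setT (tuple_affine a b).
Proof.
apply/measurable_fun_tnthP => j.
rewrite (_ : _ \o _ = fun t : n.-tuple R => a * tnth t j + tnth b j).
  apply: measurable_funD => //; apply: measurable_funM => //.
  exact: measurable_tnth.
by apply/funext => t /=; rewrite tnth_mktuple.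
Qed.

Lemma tuple_affine_cons n a (b : n.+1.-tuple R) (p : n.-tuple R * R) :
  tuple_affine a b (consR p) =
  consR (tuple_affine a [tuple of behead b] p.1, a * p.2 + tnth b 0).
Proof.
apply: eq_from_tnth => j; rewrite tnth_mktuple.
have [k ->|->] := unliftP ord0 j; last by rewrite !tnth0.
rewrite !tnthS tnth_mktuple; congr (_ + _).
by rewrite [in LHS](tuple_eta b) tnthS.
Qed.

Lemma lebesgue_tupleS n (A : set (n.+1.-tuple R)) :
  (lebesgue_tuple n.+1 A =
   \int[lebesgue_tuple n]_t lebesgue_measure [set s | A (consR (t, s))])%E.
Proof.
rewrite /= /lebesgue_step /pushforward /product_measure1.
apply: eq_integral => t _ /=; congr (lebesgue_measure _).
by apply/seteqP; split => s; rewrite /xsection/= inE.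
Qed.

Lemma measurable_consR_section n (A : set (n.+1.-tuple R)) (t : n.-tuple R) :
  measurable A -> measurable [set s | A (consR (t, s))].
Proof.
move=> mA; have mc : measurable (@consR R n @^-1` A).
  by rewrite -[X in measurable X]setTI; exact: measurable_consR.
have := measurable_xsection t mc; congr (measurable _).
by apply/seteqP; split => s; rewrite /xsection/= inE.
Qed.

Lemma measurable_lebesgue_section n (A : set (n.+1.-tuple R)) : measurable A ->
  measurable_fun setT (fun t : n.-tuple R =>
    lebesgue_measure [set s : R | A (consR (t, s))]).
Proof.
move=> mA; have mc : measurable (@consR R n @^-1` A).
  by rewrite -[X in measurable X]setTI; exact: measurable_consR.
have := measurable_fun_xsection lebesgue_measure mc; congr (measurable_fun _ _).
apply/funext => t /=; congr (lebesgue_measure _).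
by apply/seteqP; split => s; rewrite /xsection/= inE.
Qed.

(** Induction through sections: the head coordinate contributes a^-1, the tail a^-n. The inductive
    hypothesis serves as an equality of measures, to change variables in the outer integral. *)
Lemma lebesgue_tuple_affine n (a : R) (b : n.-tuple R) (A : set (n.-tuple R)) :
  0 < a -> measurable A ->
  (lebesgue_tuple n [set t | A (tuple_affine a b t)] =
   (a ^- n)%:E * lebesgue_tuple n A)%E.
Proof.
move=> a0; elim: n b A => [b A mA|n IH b A mA].
  by rewrite expr0 invr1 mul1e; congr (lebesgue_tuple 0 _); apply/seteqP; split=> t;
   rewrite /= ![tuple_affine _ _ _]tuple0 ![t]tuple0.
have mf := measurable_tuple_affine a [tuple of behead b].
rewrite !lebesgue_tupleS.
under eq_integral => t _.
  rewrite [X in lebesgue_measure X](_ : _ = [set s |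
    [set s' | A (consR (tuple_affine a [tuple of behead b] t, s'))] (a * s + tnth b 0)]).
    rewrite lebesgue_measure_affine//; last exact: measurable_consR_section.
    over.
  by apply/seteqP; split => s /=; rewrite tuple_affine_cons.
rewrite ge0_integralZl//; last 2 first.
- exact: (measurableT_comp (measurable_lebesgue_section mA) mf).
- by rewrite lee_fin invr_ge0 ltW.
pose h (t : n.-tuple R) := lebesgue_measure [set s : R | A (consR (t, s))].
have mh : measurable_fun setT h := measurable_lebesgue_section mA.
rewrite exprS invfM EFinM -muleA; congr (_ * _)%E.
transitivity (\int[pushm (lebesgue_tuple n) mf]_t h t)%E.
  by rewrite integral_pushm.
have ai0 : 0 <= a ^- n by rewrite invr_ge0 exprn_ge0// ltW.
rewrite (eq_measure_integral (mscale (NngNum ai0) (lebesgue_tuple n))).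
  by rewrite ge0_integral_mscale.
by move=> B mB _; exact: IH.
Qed.

Definition rowt n (t : n.-tuple R) : borel_mx R 1 n := \row_j tnth t j.

Lemma measurable_rowt n : measurable_fun setT (@rowt n).
Proof.
apply/measurable_matrixP => i j.
under eq_fun do rewrite mxE.
exact: measurable_tnth.
Qed.

(** [volume] as a measure on row vectors with the Borel sigma-algebra of open sets; the two are
    convertible. *)
Definition leb n : set (borel_mx R 1 n) -> \bar R :=
  pushm (lebesgue_tuple n) (@measurable_rowt n).

HB.instance Definition _ n := Measure.on (@leb n).

Lemma volumeE n (A : set 'rV[R]_n) : volume A = leb (A : set (borel_mx R 1 n)).
Proof. by []. Qed.

Lemma leb_affine n a (b : 'rV[R]_n) (A : set (borel_mx R 1 n)) :
  0 < a -> measurable A ->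
  leb ([set x | A (a *: (x : 'rV[R]_n) + b)] : set (borel_mx R 1 n)) =
  ((a ^- n)%:E * leb A)%E.
Proof.
move=> a0 mA; rewrite -(@lebesgue_tuple_affine _ a [tuple b 0 j | j < n])//.
  rewrite /leb /pushm /pushforward; congr (lebesgue_tuple n _).
  apply/seteqP; split => t /=; congr A; apply/rowP => j;
    by rewrite !mxE !tnth_mktuple.
by rewrite -[X in measurable X]setTI; exact: measurable_rowt.
Qed.

Lemma leb_translate n (b : 'rV[R]_n) (A : set (borel_mx R 1 n)) : measurable A ->
  leb ([set x | A ((x : 'rV[R]_n) + b)] : set (borel_mx R 1 n)) = leb A.
Proof.
move=> mA; have := leb_affine b ltr01 mA; rewrite expr1n invr1 mul1e => <-.
by congr leb; apply/seteqP; split => x /=; rewrite scale1r.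
Qed.

Lemma leb_dilate n a (A : set (borel_mx R 1 n)) : 0 < a -> measurable A ->
  leb ([set x | A (a^-1 *: (x : 'rV[R]_n))] : set (borel_mx R 1 n)) =
  ((a ^+ n)%:E * leb A)%E.
Proof.
move=> a0 mA; rewrite -[a in RHS]invrK exprVn -(leb_affine 0) ?invr_gt0//.
by congr leb; apply/seteqP; split => x /=; rewrite addr0.
Qed.

Lemma measurable_cube n (r : R) :
  measurable [set t : n.-tuple R | forall j, `|tnth t j| <= r].
Proof.
rewrite (_ : [set t | _] = \bigcap_(j in [set: 'I_n]) (@tnth n R ^~ j @^-1` `[-r, r])).
  apply: fin_bigcap_measurable; first exact: finite_finset.
  by move=> j _; rewrite -[X in measurable X]setTI; exact: measurable_tnth.
apply/seteqP; split => t /= ht j; first by rewrite /= in_itv/= -ler_norml.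
by have := ht j I; rewrite /= in_itv/= -ler_norml.
Qed.

Lemma lebesgue_tuple_cube_fin n (r : R) : 0 < r ->
  (lebesgue_tuple n [set t | forall j, (`|tnth t j| <= r)%R] < +oo)%E.
Proof.
move=> r0; elim: n => [|n IH]; first by rewrite /= diracE; case: (_ \in _); rewrite ltry.
rewrite lebesgue_tupleS.
rewrite (eq_integral (fun t =>
    (\1_[set t : n.-tuple R | forall j, `|tnth t j| <= r] t)%:E * (r *+ 2)%:E)%E); last first.
  move=> t _; rewrite indicE; case: (boolP (t \in _)); rewrite ?inE/= => ht.
    rewrite mul1e (_ : [set s | _] = closed_ball (0 : R) r).
      by rewrite lebesgue_measure_closed_ball// ltW.
    rewrite closed_ball_itv// sub0r add0r.
    apply/seteqP; split => s /=; rewrite in_itv/= -ler_norml => hs.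
      by have := hs ord0; rewrite tnth0.
    by move=> j; have [k ->|->] := unliftP ord0 j; rewrite ?tnth0// tnthS.
  rewrite mul0e (_ : [set s | _] = set0) ?measure0//.
  apply/seteqP; split => s //= hs; move: ht; apply: contraNP => _.
  by rewrite inE/= => j; have := hs (lift ord0 j); rewrite tnthS.
rewrite ge0_integralZr//; last 2 first.
- by apply/measurable_EFinP; apply: measurable_indic; exact: measurable_cube.
- by rewrite lee_fin mulrn_wge0// ltW.
rewrite integral_indic ?setIT//; last exact: measurable_cube.
by rewrite muleC lte_mul_pinfty// lee_fin mulrn_wge0// ltW.
Qed.

Lemma lebesgue_tupleT n : (0 < lebesgue_tuple n [set: n.-tuple R])%E.
Proof.
elim: n => [|n IH]; first by rewrite /= diracT lte01.
rewrite lebesgue_tupleS (eq_integral (cst +oo)%E).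
  by rewrite integral_cst// gt0_mulye.
move=> t _; rewrite (_ : [set s | _] = setT)//.
by rewrite /cst -[RHS](@lebesgue_measure_itv R `]-oo, +oo[) set_itvE.
Qed.

Lemma leb_eball_fin n : (leb (eball R n) < +oo)%E.
Proof.
apply: le_lt_trans (@lebesgue_tuple_cube_fin n 1 ltr01).
rewrite /leb /pushm /pushforward le_measure// ?inE.
- by rewrite -[X in measurable X]setTI; apply: measurable_rowt => //; exact: measurable_eball.
- exact: measurable_cube.
- move=> t; rewrite /eball/= => ht j.
  rewrite -(@expr_le1 _ 2)// -normrX ger0_norm ?sqr_ge0//.
  by apply: le_trans ht; apply: le_trans (dotp_coord _ j); rewrite mxE.
Qed.

Lemma eballE n (x : 'rV[R]_n) : eball R n x = (enorm x <= 1) :> Prop.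
Proof. by rewrite enorm_le// expr1n. Qed.

Lemma dilated_eball n (k : nat) :
  [set x : 'rV[R]_n | eball R n (k.+1%:R^-1 *: x)] = [set x | enorm x <= k.+1%:R].
Proof.
apply/seteqP; split=> x; rewrite /mkset eballE enormZ ?invr_ge0//;
  by rewrite ler_pdivrMl// mulr1.
Qed.

Lemma measurable_dilated_eball n (k : nat) :
  measurable ([set x | enorm x <= k.+1%:R] : set (borel_mx R 1 n)).
Proof.
rewrite -[X in measurable X]setTI (_ : [set x | _] = @enorm R n @^-1` `]-oo, k.+1%:R]).
  exact: measurable_enorm.
by apply/seteqP; split => x /=; rewrite in_itv.
Qed.

Lemma bigcup_dilated_eball n :
  \bigcup_k [set x | enorm x <= k.+1%:R] = [set: 'rV[R]_n].
Proof.
apply/seteqP; split => // x _; exists (Num.truncn (enorm x)) => //=.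
by rewrite ltW// truncnS_gt.
Qed.

Lemma leb_dilated_eball n k :
  leb ([set x | enorm x <= k.+1%:R] : set (borel_mx R 1 n)) =
  ((k.+1%:R ^+ n)%:E * leb (eball R n))%E.
Proof. by rewrite -dilated_eball leb_dilate//; exact: measurable_eball. Qed.

(** Were the ball null, so would be all its dilates, which exhaust a space of positive measure. *)
Lemma leb_eball_gt0 n : (0 < leb (eball R n))%E.
Proof.
rewrite lt0e measure_ge0 andbT; apply/eqP => B0.
suff : leb ([set: 'rV[R]_n] : set (borel_mx R 1 n)) = 0%E.
  by move=> T0; have := lebesgue_tupleT n; rewrite -[X in (0 < X)%E]/(leb setT) T0 ltxx.
apply: measure_negligible => //; rewrite -bigcup_dilated_eball.
apply: negligible_bigcup => k; exists [set x | enorm x <= k.+1%:R]; split => //.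
  exact: measurable_dilated_eball.
by rewrite [LHS]leb_dilated_eball B0 mule0.
Qed.

Lemma leb_eball_fin_num n : leb (eball R n) \is a fin_num.
Proof. by rewrite ge0_fin_numE ?measure_ge0//; exact: leb_eball_fin. Qed.

Lemma leb_sigma_finite n : sigma_finite setT (@leb n).
Proof.
exists (fun k => [set x | enorm x <= k.+1%:R]); first by rewrite bigcup_dilated_eball.
move=> k; split; first exact: measurable_dilated_eball.
rewrite leb_dilated_eball lte_mul_pinfty ?lee_fin ?exprn_ge0//.
exact: leb_eball_fin.
Qed.

HB.instance Definition _ n :=
  @Measure_isSigmaFinite.Build _ _ _ (@leb n) (@leb_sigma_finite n).

Definition leb_ball n := mfrestr (@measurable_eball R n) (leb_eball_fin n).

HB.instance Definition _ n := FiniteMeasure.on (@leb_ball n).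

Lemma leb_ballE n (A : set (borel_mx R 1 n)) :
  leb_ball A = leb (A `&` eball R n).
Proof. by []. Qed.

(** Double counting, the common tool for the rotation invariance of [leb], for uniqueness on the
    sphere and for polar coordinates. *)
Lemma tonelli_set d d' (T1 : measurableType d) (T2 : measurableType d')
    (m1 : {sigma_finite_measure set T1 -> \bar R})
    (m2 : {sigma_finite_measure set T2 -> \bar R}) (Z : set (T1 * T2)) :
  measurable Z ->
  (\int[m1]_x m2 [set y | Z (x, y)] = \int[m2]_y m1 [set x | Z (x, y)])%E.
Proof.
move=> mZ; have := indic_fubini_tonelli m1 m2 mZ.
rewrite indic_fubini_tonelli_FE// indic_fubini_tonelli_GE// => eqI.
transitivity (\int[m1]_x (m2 \o xsection Z) x)%E.
  apply: eq_integral => x _ /=; congr (m2 _).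
  by apply/seteqP; split => y; rewrite /xsection/= inE.
rewrite eqI; apply: eq_integral => y _ /=; congr (m1 _).
by apply/seteqP; split => x; rewrite /ysection/= inE.
Qed.

(** Evaluates one side of a double count in which the sections over D all have the same measure. *)
Lemma integral_guard d (T : measurableType d) (m : {measure set T -> \bar R})
    (D : set T) (h : T -> \bar R) (c : \bar R) : measurable D -> (0 <= c)%E ->
  (forall x, D x -> h x = c) -> (forall x, ~ D x -> h x = 0%E) ->
  (\int[m]_x h x = m D * c)%E.
Proof.
move=> mD c0 hD hND.
rewrite (eq_integral (fun x => (\1_D x)%:E * c)%E); last first.
  move=> x _; rewrite indicE; case: (boolP (x \in D)); rewrite ?(inE, notin_setE) => Dx.
    by rewrite mul1e hD.
  by rewrite mul0e hND.
rewrite ge0_integralZr//; last by apply/measurable_EFinP; exact: measurable_indic.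
by rewrite integral_indic// setIT.
Qed.

(* For a rotation-invariant set B, leb A * leb B and leb {x | x Q in A} * leb B
   are the two iterated integrals of 1_A(x + y Q) 1_B(y), up to translations. *)
Lemma leb_rotate n (Q : 'M[R]_n) (A : set (borel_mx R 1 n)) :
  orthogonal_mx Q -> measurable A ->
  leb ([set x | A ((x : 'rV[R]_n) *m Q)] : set (borel_mx R 1 n)) = leb A.
Proof.
move=> oQ mA; pose V := borel_mx R 1 n.
pose B : set V := eball R n.
have mB : measurable B := @measurable_eball R n.
have mQ : measurable_fun setT (fun x : V => (x : 'rV[R]_n) *m Q : V).
  by apply: measurable_mulmx.
have mQ2 : measurable_fun setT (fun z : V * V => (z.2 : 'rV[R]_n) *m Q : V).
  exact: (measurableT_comp mQ).
pose C : set V := [set y : V | A ((y : 'rV[R]_n) *m Q)].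
have mAQ : measurable C.
  by rewrite -[X in measurable X]setTI; exact: mQ.
pose Z : set (V * V) := [set z | B z.2 /\ A ((z.1 : 'rV[R]_n) + (z.2 : 'rV[R]_n) *m Q)].
pose Z' : set (V * V) := [set z | A ((z.2 : 'rV[R]_n) *m Q) /\
                            B ((z.1 : 'rV[R]_n) - (z.2 : 'rV[R]_n) *m Q)].
have mZ : measurable Z.
  apply: measurableI.
    by rewrite -[X in measurable X]setTI; apply: measurable_snd.
  rewrite -[X in measurable X]setTI.
  by apply: (@measurable_addmx R _ (V * V)%type) => //; exact: measurable_fst.
have mZ' : measurable Z'.
  apply: measurableI; first by rewrite -[X in measurable X]setTI; apply: mQ2.
  rewrite -[X in measurable X]setTI.
  apply: (@measurable_addmx R _ (V * V)%type) => //.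
  rewrite (_ : (fun z => _) = fun z : V * V => (-1 : R) *: ((z.2 : 'rV[R]_n) *m Q)).
    exact: measurable_scalemx.
  by apply/funext => z; rewrite scaleN1r.
have swap : (\int[@leb n]_x @leb n [set y | Z (x, y)] =
             \int[@leb n]_x @leb n [set y | Z' (x, y)])%E.
  apply: eq_integral => x _.
  have mZx : measurable [set y | Z' (x, y)].
    have := measurable_xsection x mZ'; congr (measurable _).
    by apply/seteqP; split => y; rewrite /xsection/= inE.
  (* Replacing y by y + x Q^T turns the conditions of [Z'] into y Q + x in A and - y Q in B; B is
     symmetric and invariant under Q, so these are the conditions of [Z]. *)
  rewrite -(leb_translate ((x : 'rV[R]_n) *m Q^T) mZx); congr leb.
  have BN (u : 'rV[R]_n) : B (- u) = B u.
    by rewrite /B/eball/= dotpNl dotpNr opprK.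
  have Bs (y : 'rV[R]_n) : B ((x : 'rV[R]_n) - (y *m Q + (x : 'rV[R]_n))) = B y.
    rewrite [y *m Q + _]addrC opprD addrA subrr add0r BN.
    by rewrite /B /eball/= dotp_isometry.
  apply/seteqP; split => y; rewrite /Z /Z'/= mulmxDl orthogonal_mxVK// Bs addrC.
    by case.
  by case.
have I1 : (\int[@leb n]_y @leb n [set x | Z (x, y)] = @leb n B * leb A)%E.
  apply: integral_guard; [exact: mB|exact: measure_ge0| |].
    move=> y By; rewrite -(leb_translate ((y : 'rV[R]_n) *m Q) mA); congr leb.
    by apply/seteqP; split => x; rewrite /Z/=; [case|].
  move=> y nBy; rewrite (_ : [set x | _] = set0) ?measure0//.
  by apply/seteqP; split => x //; rewrite /Z/=; case.
have I2 : (\int[@leb n]_y @leb n [set x | Z' (x, y)] =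
           @leb n C * leb B)%E.
  apply: integral_guard;
    [exact: mAQ|exact: measure_ge0| |].
    move=> y Ay; rewrite -(leb_translate (- ((y : 'rV[R]_n) *m Q)) mB); congr leb.
    by apply/seteqP; split => x; rewrite /Z'/=; [case|].
  move=> y nAy; rewrite (_ : [set x | _] = set0) ?measure0//.
  by apply/seteqP; split => x //; rewrite /Z'/=; case.
have : (@leb n B * leb A = @leb n [set y | A ((y : 'rV[R]_n) *m Q)] * leb B)%E.
  by rewrite -I1 -(tonelli_set (@leb n) (@leb n) mZ) swap (tonelli_set (@leb n) (@leb n) mZ') I2.
rewrite muleC => /mule_pinjr -> //.
- exact: leb_eball_fin_num.
- exact: leb_eball_gt0.
Qed.

End lebesgue.

(** * Rotation-invariant measures on the sphere *)

Section uniqueness.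
Context {R : realType}.

Definition rotation_invariant n (m : set (borel_mx R 1 n) -> \bar R) :=
  forall Q, orthogonal_mx Q -> forall A : set (borel_mx R 1 n), measurable A ->
    m [set x | A ((x : 'rV[R]_n) *m Q)] = m A.

(** Householder reflection in the hyperplane orthogonal to v = x - y. As x and y have the same norm,
    <x, v> = |v|^2 / 2, so x is sent to x - v = y. *)
Lemma reflection_sphere n (x y : 'rV[R]_n) : sphere R n x -> sphere R n y ->
  exists2 Q, orthogonal_mx Q & x *m Q = y.
Proof.
rewrite /sphere/= => x1 y1; have [<-|xy] := eqVneq x y.
  by exists 1%:M; rewrite /orthogonal_mx ?trmx1 mulmx1.
pose v := x - y; have v0 : dotp v v != 0 by rewrite dotp_eq0 subr_eq0.
have vv : v *m v^T = (dotp v v)%:M by rewrite [LHS]mx11_scalar -dotpE.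
have xv : dotp x v = dotp v v / 2.
  have -> : dotp v v = 2 * dotp x v.
    rewrite /v !(dotpDl, dotpDr, dotpNl, dotpNr) x1 y1 [dotp y x]dotpC.
    by rewrite mulr2n; ring.
  by field.
(* P is the rank-one matrix v^T v; only these three identities are used afterwards. *)
have [P [PT PP xP]] : exists P : 'M[R]_n,
    [/\ P^T = P, P *m P = dotp v v *: P & x *m P = dotp x v *: v].
  exists (v^T *m v); split; first by rewrite trmx_mul trmxK.
    by rewrite mulmxA -(mulmxA v^T) vv mul_mx_scalar -scalemxAl.
  rewrite mulmxA; have -> : x *m v^T = (dotp x v)%:M by rewrite [LHS]mx11_scalar -dotpE.
  by rewrite mul_scalar_mx.
exists (1%:M - (2 / dotp v v) *: P).
  rewrite /orthogonal_mx.
  have -> : (1%:M - (2 / dotp v v) *: P)^T = 1%:M - (2 / dotp v v) *: P.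
    by apply/matrixP => i j; rewrite !mxE -[in LHS]PT mxE eq_sym.
  rewrite mulmxBl mul1mx mulmxBr mulmx1 -scalemxAl -scalemxAr PP.
  by apply/matrixP => i j; rewrite !mxE; field.
rewrite mulmxBr mulmx1 -scalemxAr xP scalerA xv.
have -> : 2 / dotp v v * (dotp v v / 2) = 1 by field.
by rewrite scale1r /v subKr.
Qed.

(** The open Euclidean ball of squared radius s. The topological [ball] of matrices is that of the
    sup norm, which rotations do not preserve. *)
Definition sqball n (s : R) (x : 'rV[R]_n) : set 'rV[R]_n :=
  [set y | dotp (y - x) (y - x) < s].

Lemma sqball_sym n s (x y : 'rV[R]_n) : sqball s x y = sqball s y x.
Proof. by rewrite /sqball/= -opprB dotpNl dotpNr opprK. Qed.

Lemma measurable_addN d (T : measurableType d) n (f g : T -> borel_mx R 1 n) :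
  measurable_fun setT f -> measurable_fun setT g ->
  measurable_fun setT
    (fun t => (f t : 'rV[R]_n) - (g t : 'rV[R]_n) : borel_mx R 1 n).
Proof.
move=> mf mg; under eq_fun do rewrite -scaleN1r.
by apply: measurable_addmx => //; exact: measurable_scalemx.
Qed.

Lemma measurable_sqball_prod n s :
  measurable [set z : borel_mx R 1 n * borel_mx R 1 n | sqball s z.1 z.2].
Proof.
rewrite -[X in measurable X]setTI (_ : mkset _ =
  (fun z : borel_mx R 1 n * borel_mx R 1 n =>
    dotp ((z.2 : 'rV[R]_n) - z.1) ((z.2 : 'rV[R]_n) - z.1)) @^-1` `]-oo, s[).
  by apply: measurable_dotp => //; exact: measurable_addN.
by apply/seteqP; split => z /=; rewrite in_itv.
Qed.

Lemma measurable_sqball n s (x : 'rV[R]_n) :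
  measurable (sqball s x : set (borel_mx R 1 n)).
Proof.
have := measurable_xsection (x : borel_mx R 1 n) (@measurable_sqball_prod n s).
by congr (measurable _); apply/seteqP; split => y; rewrite /xsection/= inE.
Qed.

Lemma open_sqball n s (x : 'rV[R]_n) : open (sqball s x).
Proof.
rewrite (_ : sqball s x = (fun y => dotp (y - x) (y - x)) @^-1` `]-oo, s[); last first.
  by apply/seteqP; split => y /=; rewrite in_itv.
apply: open_comp; last exact: lray_open.
move=> y _; move: y; pose F r (y : 'rV[R]_n) := \sum_(j <- r) (y - x) 0 j * (y - x) 0 j.
suff cF r : continuous (F r) by exact: cF.
elim: r => [|j r IH].
  rewrite (_ : F [::] = cst 0); first exact: cst_continuous.
  by apply/funext => y; rewrite /F big_nil.
rewrite (_ : F (j :: r) = fun y => (y 0 j - x 0 j) * (y 0 j - x 0 j) + F r y); last first.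
  by apply/funext => y; rewrite /F big_cons !mxE.
move=> y.
have cB : {for y, continuous (fun y : 'rV[R]_n => y 0 j - x 0 j)}.
  by apply: continuousB; [exact: coord_continuous|exact: cst_continuous].
apply: (@continuousD _ _ _ (fun y : 'rV[R]_n => (y 0 j - x 0 j) * (y 0 j - x 0 j)));
  [exact: continuousM|exact: IH].
Qed.

(** A coordinate is bounded by the Euclidean norm, so a squared radius below e^2 fits in the
    sup-norm ball of radius e. *)
Lemma sub_sqball n (U : set 'rV[R]_n) x : open U -> U x ->
  exists k : nat, sqball k.+1%:R^-1 x `<=` U.
Proof.
move=> oU Ux; have /nbhs_ballP[e /= e0 eU] : nbhs x U by exact: open_nbhs_nbhs.
have e20 : 0 < e ^+ 2 by rewrite exprn_gt0.
have [k _ /(_ k (leqnn _)) ke] := near_infty_natSinv_lt (PosNum e20).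
exists k => y; rewrite /sqball/= => yx; apply: eU; split => // i j.
rewrite ballR/= distrC ord1.
rewrite -ltr_sqr; [|by rewrite nnegrE|by rewrite nnegrE ltW].
rewrite -normrX ger0_norm ?sqr_ge0//.
apply: le_lt_trans (lt_trans yx ke).
by apply: le_trans (dotp_coord _ j); rewrite !mxE.
Qed.

(** Dividing the squared radius by 4 halves the radius; the triangle inequality takes the form |a -
    b|^2 <= 2 |a|^2 + 2 |b|^2. *)
Lemma sqball_trans n s (x y z : 'rV[R]_n) :
  sqball (s / 4) y x -> sqball (s / 4) y z -> sqball s z x.
Proof.
rewrite /sqball/= => xy zy.
have -> : x - z = (x - y) - (z - y) by rewrite opprB addrA subrK.
move: (x - y) (z - y) xy zy => a b aa bb; have := dotp_ge0 (a + b).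
by rewrite !(dotpDl, dotpDr, dotpNl, dotpNr); lra.
Qed.

Lemma leb_sqball_gt0 n s (x : 'rV[R]_n) : 0 < s ->
  (0 < leb (sqball s x : set (borel_mx R 1 n)))%E.
Proof.
(* Half the radius, so that a closed ball fits inside the open one. *)
move=> s0; have a0 : 0 < Num.sqrt s / 2 by rewrite divr_gt0// sqrtr_gt0.
have mB := @measurable_eball R n.
rewrite -(leb_translate x (measurable_sqball s x)).
apply: (@lt_le_trans _ _ (leb ([set y | eball R n ((Num.sqrt s / 2)^-1 *: y)]
    : set (borel_mx R 1 n)))).
  by rewrite leb_dilate// mule_gt0 ?leb_eball_gt0// lte_fin exprn_gt0.
apply: le_measure; rewrite ?inE.
- rewrite -[X in measurable X]setTI.
  exact: (@measurable_scalemx R _ (borel_mx R 1 n)).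
- rewrite -[X in measurable X]setTI.
  apply: (@measurable_addmx R _ (borel_mx R 1 n)) => //.
  exact: measurable_sqball.
- move=> y; rewrite /mkset eballE enormZ; last by rewrite invr_ge0 ltW.
  rewrite ler_pdivrMl// mulr1.
  rewrite (enorm_le _ (ltW a0)) => /le_lt_trans ys.
  change (dotp ((y : 'rV[R]_n) + x - x) ((y : 'rV[R]_n) + x - x) < s).
  rewrite addrK; apply: ys.
  by rewrite expr_div_n sqr_sqrtr ?ltW//; lra.
Qed.

(** O(n) is transitive on the sphere, so the mass of a ball centred there depends on its radius
    alone. *)
Lemma rotation_invariant_sqball n (m : set (borel_mx R 1 n) -> \bar R) s x y :
  rotation_invariant m -> sphere R n x -> sphere R n y ->
  m (sqball s x) = m (sqball s y).
Proof.
move=> mQ Sx Sy; have [Q oQ <-] := reflection_sphere Sx Sy.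
rewrite -(mQ Q oQ (sqball s (x *m Q))); last exact: measurable_sqball.
by congr m; apply/seteqP; split => z; rewrite /sqball/= -mulmxBl dotp_isometry.
Qed.

Section carried.
Context n (m : {measure set (borel_mx R 1 n) -> \bar R}).
Hypothesis mS : m (~` sphere R n) = 0%E.

Lemma carried_sphereI (A : set (borel_mx R 1 n)) : measurable A ->
  m (sphere R n `&` A) = m A.
Proof.
move=> mA; have mSp := @measurable_sphere R n.
rewrite -[in RHS](setIT A) -(setUv (sphere R n)) setIUr measureU0.
- by rewrite setIC.
- exact: measurableI.
- by apply: measurableI => //; exact: measurableC.
apply: (@subset_measure0 _ _ _ m _ (~` sphere R n)) => //.
- by apply: measurableI => //; exact: measurableC.
- exact: measurableC.
Qed.

End carried.

(* Averaged over y against Lebesgue measure, the mass of sqball (s / 4) y is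
   positive, so some such ball has positive mass; it meets the sphere and is
   contained in a ball of parameter s centred at a point of the sphere. *)
Lemma sqball_gt0 n (m : {finite_measure set (borel_mx R 1 n) -> \bar R}) s x :
  m (~` sphere R n) = 0%E -> rotation_invariant m -> m setT != 0%E ->
  0 < s -> sphere R n x -> (0 < m (sqball s x))%E.
Proof.
move=> mS mQ m0 s0 Sx; pose V := borel_mx R 1 n.
rewrite lt0e measure_ge0 andbT; apply: contra m0 => /eqP ms.
have mZ := @measurable_sqball_prod n (s / 4).
have := tonelli_set m (@leb R n) mZ.
have -> : (\int[leb (n:=n)]_y m [set x0 | sqball (s / 4) x0 y] = 0)%E.
  apply: integral0_eq => y _.
  have mB : measurable ([set z | sqball (s / 4) z y] : set V).
    have := measurable_sqball (s / 4) y; congr (measurable _).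
    by apply/seteqP; split=> z /=; rewrite sqball_sym.
  have [[z [Sz yz]]|none] := pselect (exists z, sphere R n z /\ sqball (s / 4) y z).
    apply: (@subset_measure0 _ _ _ m _ (sqball s z)) => //.
    - exact: measurable_sqball.
    - by move=> t /=; rewrite sqball_sym => yt; exact: sqball_trans yt yz.
    - by rewrite -ms; exact: rotation_invariant_sqball.
  apply: (@subset_measure0 _ _ _ m _ (~` sphere R n)) => //.
  - by apply: measurableC; exact: measurable_sphere.
  - by move=> z /=; rewrite sqball_sym => yz Sz; apply: none; exists z.
pose c := leb (sqball (s / 4) (0 : 'rV[R]_n) : set V).
have c0 : (0 < c)%E by apply: leb_sqball_gt0; rewrite divr_gt0.
rewrite (_ : integral _ _ _ = m setT * c)%E; last first.
  apply: integral_guard => //; [exact: ltW| |by move=> y []].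
  move=> y _; rewrite /c -(leb_translate (- (y : 'rV[R]_n))); last exact: measurable_sqball.
  by congr leb; apply/seteqP; split => z; rewrite /sqball/= subr0.
by move/eqP; rewrite mule_eq0 [c == _]gt_eqF// orbF.
Qed.

(** * Comparison of two invariant measures carried by the sphere *)

Section two_measures.
Context n (m1 m2 : {finite_measure set (borel_mx R 1 n) -> \bar R}).
Hypothesis m1S : m1 (~` sphere R n) = 0%E.
Hypothesis m2S : m2 (~` sphere R n) = 0%E.
Hypothesis m1Q : rotation_invariant m1.
Hypothesis m2Q : rotation_invariant m2.
Hypothesis m1T : m1 setT != 0%E.
Hypothesis m2T : m2 setT != 0%E.

Let S : set (borel_mx R 1 n) := sphere R n.
Let mS : measurable S := @measurable_sphere R n.

Let measurable_ball_section (A C : set (borel_mx R 1 n)) s : measurable A ->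
  measurable C ->
  measurable [set z : borel_mx R 1 n * borel_mx R 1 n |
    A z.1 /\ C z.2 /\ sqball s z.1 z.2].
Proof.
move=> mA mC; apply: measurableI.
  by rewrite -[X in measurable X]setTI; exact: measurable_fst.
apply: measurableI; last exact: measurable_sqball_prod.
by rewrite -[X in measurable X]setTI; exact: measurable_snd.
Qed.

(* Tonelli applied to the set of pairs of points at squared distance < s. *)
Let sqball_mass s y : S y ->
  (m2 setT * m1 (sqball s y) = m1 setT * m2 (sqball s y))%E.
Proof.
move=> Sy; have mZ := measurable_ball_section s mS mS.
have := tonelli_set m1 m2 mZ.
rewrite (_ : integral m1 _ _ = m1 S * m2 (sqball s y))%E; last first.
  apply: integral_guard => // x Sx.
    rewrite -(rotation_invariant_sqball s m2Q Sx Sy).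
    rewrite -[RHS]carried_sphereI//; last exact: measurable_sqball.
    by congr (m2 _); apply/seteqP; split => z /=; [case|].
  by rewrite (_ : [set _ | _] = set0) ?measure0//; apply/seteqP; split => z //= [].
rewrite (_ : integral m2 _ _ = m2 S * m1 (sqball s y))%E; last first.
  apply: integral_guard => // x Sx.
    rewrite -(rotation_invariant_sqball s m1Q Sx Sy).
    rewrite -[RHS]carried_sphereI//; last exact: measurable_sqball.
    congr (m1 _); apply/seteqP; split => z /=; rewrite sqball_sym.
      by case=> ? [].
    by case.
  by rewrite (_ : [set _ | _] = set0) ?measure0//; apply/seteqP; split => z //= [? []].
have carT (m : {measure set (borel_mx R 1 n) -> \bar R}) :
    m (~` sphere R n) = 0%E -> m S = m setT.
  by move=> m0; rewrite -(carried_sphereI m0 measurableT) setIT.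
by rewrite (carT m1)// (carT m2)// => <-.
Qed.

(** Inner approximation of U on the sphere: a ball of squared radius 1/(k+1) centred in it stays in
    U, and for open U these sets increase to the trace of U on the sphere. *)
Let inner (U : set 'rV[R]_n) (k : nat) : set (borel_mx R 1 n) :=
  S `&` [set x | sqball k.+1%:R^-1 x `<=` U].

Let measurable_inner U k : measurable (inner U k).
Proof.
apply: measurableI => //.
(* By symmetry of [sqball], the excluded points are those of the open balls centred outside U. *)
rewrite (_ : [set x | _] = ~` \bigcup_(y in ~` U) sqball k.+1%:R^-1 y).
  apply: measurableC; apply: open_measurable_borel; apply: bigcup_open => y _.
  exact: open_sqball.
apply/seteqP; split => x /= xU.
  by move=> [y nUy]; rewrite sqball_sym => /xU.
by move=> y xy; apply: contrapT => nUy; apply: xU; exists y => //; rewrite sqball_sym.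
Qed.

(* Same as above, for the pairs (x, y) with x in inner U k and y in U. *)
Let inner_le U k : open U -> (m2 setT * m1 (inner U k) <= m1 setT * m2 U)%E.
Proof.
move=> oU; have mU := open_measurable_borel oU.
have [S0|] := pselect (exists x, S x); last first.
  move=> S0; rewrite (_ : inner U k = set0) ?measure0 ?mule0 ?mule_ge0//.
  by apply/seteqP; split => x // [Sx _]; apply: S0; exists x.
have [y Sy] := S0; pose s : R := k.+1%:R^-1.
have s0 : 0 < s by rewrite invr_gt0.
have mD z : measurable (sqball s z : set (borel_mx R 1 n)) := measurable_sqball s z.
pose US : set (borel_mx R 1 n) := (U : set (borel_mx R 1 n)) `&` S.
have mUS : measurable US by exact: measurableI.
(* After multiplication by the total mass of m2, [sqball_mass] exchanges the two ball masses, and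
   the positive finite factor [m2 (sqball s y)] cancels. *)
suff : (m1 (inner U k) * m2 (sqball s y) <= m2 U * m1 (sqball s y))%E.
  have g0 : (0 < m2 (sqball s y))%E by exact: sqball_gt0.
  have gf : m2 (sqball s y) \is a fin_num by exact: fin_num_measure.
  move=> h; rewrite -(lee_pmul2r gf g0) -!muleA.
  apply: (@le_trans _ _ (m2 setT * (m2 U * m1 (sqball s y))))%E.
    by rewrite lee_pmul2l// ?fin_num_measure// lt0e m2T measure_ge0.
  have -> : (m1 setT * (m2 U * m2 (sqball s y)) = m2 U * (m1 setT * m2 (sqball s y)))%E.
      exact: muleCA.
    by rewrite -(sqball_mass s Sy) muleCA.
have mZ := measurable_ball_section s (measurable_inner U k) mUS.
have mZ' := measurable_ball_section s mS mUS.
have <- : (\int[m1]_x m2 [set z | inner U k x /\ US z /\ sqball s x z] =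
  m1 (inner U k) * m2 (sqball s y))%E.
  apply: integral_guard => // x.
    move=> [Sx xU]; rewrite -(rotation_invariant_sqball s m2Q Sx Sy).
    rewrite -[RHS]carried_sphereI//.
    congr (m2 _); apply/seteqP; split => z /=; first by case=> ? [[]].
    by move=> [Sz xz]; do !split => //; exact: xU.
  by move=> nx; rewrite (_ : [set _ | _] = set0) ?measure0//; apply/seteqP; split => z //= [].
have <- : (\int[m2]_z m1 [set x | S x /\ US z /\ sqball s x z] =
  m2 U * m1 (sqball s y))%E.
  rewrite -[in RHS](carried_sphereI m2S mU) setIC.
  apply: integral_guard => // x.
    move=> [Ux Sx]; rewrite -(rotation_invariant_sqball s m1Q Sx Sy).
    rewrite -[RHS]carried_sphereI//.
    congr (m1 _); apply/seteqP; split => z /=; rewrite sqball_sym.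
      by case=> ? [].
    by case.
  by move=> nx; rewrite (_ : [set _ | _] = set0) ?measure0//; apply/seteqP; split => z //= [? []].
have := tonelli_set m1 m2 mZ => /= ->.
apply: ge0_le_integral => //.
- have := measurable_fun_ysection m1 mZ; congr (measurable_fun _ _).
  apply/funext => z /=; congr (m1 _).
  by apply/seteqP; split => x; rewrite /ysection/= inE.
- have := measurable_fun_ysection m1 mZ'; congr (measurable_fun _ _).
  apply/funext => z /=; congr (m1 _).
  by apply/seteqP; split => x; rewrite /ysection/= inE.
- move=> z _; apply: le_measure; rewrite ?inE.
  + have := measurable_ysection z mZ; congr (measurable _).
    by apply/seteqP; split => x; rewrite /ysection/= inE.
  + have := measurable_ysection z mZ'; congr (measurable _).
    by apply/seteqP; split => x; rewrite /ysection/= inE.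
  + by move=> x /= [[Sx _] ?].
Qed.

(** Continuity of m1 from below along the sets [inner U k], which exhaust the part of U on the
    sphere. *)
Lemma rotation_invariant_le_open (U : set 'rV[R]_n) : open U ->
  (m2 setT * m1 U <= m1 setT * m2 U)%E.
Proof.
move=> oU; have mU := open_measurable_borel oU.
have mI k : measurable (inner U k) := measurable_inner U k.
rewrite -(carried_sphereI m1S mU).
have UE : S `&` U = \bigcup_k inner U k.
  apply/seteqP; split => [x [Sx Ux]|x [k _ [Sx xU]]].
    by have [k xk] := sub_sqball oU Ux; exists k.
  by split => //; apply: xU; rewrite /sqball/= subrr dotp0l invr_gt0.
have h : (m2 setT * m1 (inner U k))%E @[k --> \oo] --> (m2 setT * m1 (S `&` U))%E.
  apply: cvgeZl; first exact: fin_num_measure.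
  rewrite UE; apply: nondecreasing_cvg_mu => //; first exact: bigcupT_measurable.
  move=> j k jk; apply/subsetPset => x [Sx xU]; split => // y xy; apply: xU.
  by apply: lt_le_trans xy _; rewrite lef_pV2 ?posrE// ler_nat.
rewrite -(cvg_lim _ h)//; apply: lime_le; first by apply/cvg_ex; eexists; exact: h.
by apply: nearW => k; exact: inner_le.
Qed.

End two_measures.

(* The total masses are kept as factors so that null measures are covered. *)
Lemma rotation_invariant_unique n
    (m1 m2 : {finite_measure set (borel_mx R 1 n) -> \bar R}) :
  m1 (~` sphere R n) = 0%E -> m2 (~` sphere R n) = 0%E ->
  rotation_invariant m1 -> rotation_invariant m2 ->
  forall A : set (borel_mx R 1 n), measurable A ->
  (m2 setT * m1 A = m1 setT * m2 A)%E.
Proof.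
move=> m1S m2S m1Q m2Q.
have null (m : {finite_measure set (borel_mx R 1 n) -> \bar R}) :
    m setT = 0%E -> forall A : set (borel_mx R 1 n), measurable A -> m A = 0%E.
  by move=> m0 A mA; exact: (@subset_measure0 _ _ _ m _ setT).
have [m1T|m1T] := eqVneq (m1 setT) 0%E.
  by move=> A mA; rewrite (null m1 m1T A)// m1T mul0e mule0.
have [m2T|m2T] := eqVneq (m2 setT) 0%E.
  by move=> A mA; rewrite (null m2 m2T A)// m2T mul0e mule0.
have ge0 (m : {finite_measure set (borel_mx R 1 n) -> \bar R}) :
  0 <= fine (m setT) by rewrite fine_ge0.
pose k1 := NngNum (ge0 m1); pose k2 := NngNum (ge0 m2).
have fE (m : {finite_measure set (borel_mx R 1 n) -> \bar R}) :
    (fine (m setT))%:E = m setT by rewrite fineK// fin_num_measure.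
move=> A mA; rewrite -(fE m1) -(fE m2) -[LHS]/(mscale k2 m1 A) -[RHS]/(mscale k1 m2 A).
(* Open sets form a generating pi-system; equality on them is the inequality used twice, with m1 and
   m2 exchanged. *)
apply: (@measure_unique _ R (borel_mx R 1 n) (@open 'rV[R]_n) (fun _ => setT) _ _ _ _
  (mscale k2 m1) (mscale k1 m2)) => //.
- exact: openI.
- by move=> _; exact: openT.
- by rewrite bigcup_const.
- move=> U oU.
  change ((fine (m2 setT))%:E * m1 U = (fine (m1 setT))%:E * m2 U)%E.
  rewrite !fE; apply/le_anti/andP.
  by split; exact: rotation_invariant_le_open.
- move=> _; change ((fine (m2 setT))%:E * m1 setT < +oo)%E.
  by rewrite ltey_eq fin_numM// fin_num_measure.
Qed.

Lemma rotation_invariant_integral n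
    (m1 m2 : {finite_measure set (borel_mx R 1 n) -> \bar R})
    (f : borel_mx R 1 n -> \bar R) :
  m1 (~` sphere R n) = 0%E -> m2 (~` sphere R n) = 0%E ->
  rotation_invariant m1 -> rotation_invariant m2 ->
  measurable_fun setT f -> (forall x, 0 <= f x)%E ->
  (m2 setT * \int[m1]_x f x = m1 setT * \int[m2]_x f x)%E.
Proof.
move=> m1S m2S m1Q m2Q mf f0.
have ge0 (m : {finite_measure set (borel_mx R 1 n) -> \bar R}) :
  0 <= fine (m setT) by rewrite fine_ge0.
have fE (m : {finite_measure set (borel_mx R 1 n) -> \bar R}) :
    (fine (m setT))%:E = m setT by rewrite fineK// fin_num_measure.
pose k1 := NngNum (ge0 m1); pose k2 := NngNum (ge0 m2).
rewrite -(fE m1) -(fE m2) -(ge0_integral_mscale _ _ k2)//.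
rewrite -(ge0_integral_mscale _ _ k1)//.
apply: eq_measure_integral => A mA _.
change ((fine (m2 setT))%:E * m1 A = (fine (m1 setT))%:E * m2 A)%E; rewrite !fE.
exact: rotation_invariant_unique.
Qed.

End uniqueness.

(** * Polar coordinates *)

Section polar.
Context {R : realType}.

(** Half-open intervals form a generating pi-system and are differences of half-lines; finiteness on
    half-lines legitimates the subtraction. *)
Lemma half_line_measure_unique (m1 m2 : {measure set R -> \bar R}) :
  (forall a : R, m1 `]-oo, a]%classic = m2 `]-oo, a]%classic) ->
  (forall a : R, m1 `]-oo, a]%classic < +oo)%E ->
  forall A : set R, measurable A -> m1 A = m2 A.
Proof.
move=> m12 m1oo.
have itvE (m : {measure set R -> \bar R}) (x y : R) : x < y ->
    (m `]-oo, y]%classic < +oo)%E ->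
    (m `]x, y]%classic = m `]-oo, y]%classic - m `]-oo, x]%classic)%E.
  move=> xy moo.
  rewrite (_ : `]x, y]%classic = `]-oo, y]%classic `\` `]-oo, x]%classic); last first.
    apply/seteqP; split => t /=; rewrite !in_itv/=.
      by move=> /andP[xt ty]; split=> //; apply/negP; rewrite -ltNge.
    by move=> [-> /negP]; rewrite -ltNge => ->.
  rewrite measureD//; congr (_ - m _)%E.
  apply/seteqP; split => t /=; rewrite !in_itv/=; first by case.
  by move=> tx; split => //; exact: le_trans tx (ltW xy).
apply: (@measure_unique _ R [the measurableType default_measure_display of (R : Type)] (@ocitv R)
  (fun k : nat => `](- k%:R), k%:R]%classic) _ _ _ _ m1 m2) => //.
- exact: ocitvI.
- by move=> k; exact: is_ocitv.
- apply/seteqP; split => // x _; exists (Num.truncn `|x|).+1 => //=.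
  rewrite in_itv/=; have /ltr_normlP[h1 h2] : `|x| < (Num.truncn `|x|).+1%:R.
    exact: truncnS_gt.
  by rewrite ltrNl h1 ltW.
- move=> _ [[x y] _ <-] /=; have [xy|yx] := ltP x y.
    by rewrite (itvE m1)// (itvE m2) -?m12.
  by rewrite set_itv_ge ?bnd_simp -?leNgt// !measure0.
- move=> k; apply: le_lt_trans (m1oo k%:R).
  apply: le_measure; rewrite ?inE//.
  by move=> x /=; rewrite !in_itv/= => /andP[].
Qed.

(** The origin is fixed by the dilation of ratio 2, so its finite mass equals 2^n times itself. *)
Lemma leb_set0 n : (0 < n)%N -> leb ([set 0] : set (borel_mx R 1 n)) = 0%E.
Proof.
move=> n0; pose V := borel_mx R 1 n.
have m0 : measurable ([set 0] : set V).
  rewrite -[X in measurable X]setTI (_ : [set 0] = @enorm R n @^-1` [set 0]).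
    by apply: measurable_enorm => //; exact: measurable_set1.
  by apply/seteqP; split => x /= => [->|/eqP]; rewrite ?enorm0// enorm_eq0 => /eqP.
have zf : leb ([set 0] : set V) \is a fin_num.
  rewrite ge0_fin_numE ?measure_ge0//; apply: le_lt_trans (leb_eball_fin n).
  apply: le_measure; rewrite ?inE//; first exact: measurable_eball.
  by move=> x ->; rewrite eballE enorm0.
have := leb_dilate (ltr0n R 2) m0.
rewrite (_ : [set x | _] = [set 0] :> set V); last first.
  apply/seteqP; split => x /= => [/eqP|->]; last by rewrite scaler0.
  by rewrite scaler_eq0 invr_eq0 pnatr_eq0/= => /eqP.
rewrite -(fineK zf) -EFinM => -[].
move/eqP; rewrite -subr_eq0 -{1}[fine _]mul1r -mulrBl mulf_eq0 subr_eq0 eq_sym.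
by rewrite gt_eqF ?exprn_egt1 ?ltr1n -?lt0n//= => /eqP ->.
Qed.

(** The mass of a set A of directions is the volume of the cone over A in the unit ball, that is,
    surface measure divided by n. No surface measure has to be built. *)
Definition cone_measure n := pushm (@leb_ball R n) (@measurable_unitv R n).

HB.instance Definition _ n := FiniteMeasure.on (@cone_measure n).


Arguments cone_measure n : clear implicits.

(** For n > 0 this is the measure with density n |B_2^n| r^(n-1) on the half-line, handled only
    through its values |B_2^n| a^n on []-oo, a]]. *)
Definition radial_measure n := pushm (@leb R n) (@measurable_enorm R n).

HB.instance Definition _ n := Measure.on (@radial_measure n).

Arguments radial_measure n : clear implicits.

Lemma radial_measure_le n (a : R) : (0 < n)%N -> 0 <= a ->
  (radial_measure n `]-oo, a]%classic = (a ^+ n)%:E * leb (eball R n))%E.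
Proof.
move=> n0; rewrite le_eqVlt => /predU1P[<-|a0].
  rewrite expr0n gtn_eqF// mul0e -[RHS](leb_set0 n0) /radial_measure/pushm/pushforward.
  congr leb; apply/seteqP; split => x /=; rewrite in_itv/=.
    by rewrite le_eqVlt ltNge enorm_ge0 orbF enorm_eq0 => /eqP.
  by move=> ->; rewrite enorm0.
rewrite -leb_dilate//; last exact: measurable_eball.
congr leb; apply/seteqP; split => x; rewrite /preimage/mkset in_itv/= eballE.
  by rewrite enormZ ?invr_ge0 ?(ltW a0)// ler_pdivrMl// mulr1.
by rewrite enormZ ?invr_ge0 ?(ltW a0)// ler_pdivrMl// mulr1.
Qed.

Lemma radial_measure_lt0 n (a : R) : a < 0 -> radial_measure n `]-oo, a]%classic = 0%E.
Proof.
move=> a0; rewrite /radial_measure/pushm/pushforward (_ : _ @^-1` _ = set0) ?measure0//.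
by apply/seteqP; split => x //=; rewrite in_itv/= leNgt (lt_le_trans a0)// enorm_ge0.
Qed.

Lemma radial_measure_fin n (a : R) : (0 < n)%N -> (radial_measure n `]-oo, a]%classic < +oo)%E.
Proof.
move=> n0; have [a0|a0] := leP 0 a.
  by rewrite radial_measure_le// ltey_eq fin_numM// leb_eball_fin_num.
by rewrite radial_measure_lt0.
Qed.

Lemma radial_measure_sigma_finite n : sigma_finite setT (radial_measure n.+1).
Proof.
exists (fun k => `]-oo, k%:R]%classic).
  apply/seteqP; split => // x _; exists (Num.truncn `|x|).+1 => //=.
  rewrite in_itv/=; apply: le_trans (ler_norm _) _.
  by rewrite ltW// truncnS_gt.
by move=> k; split => //; exact: radial_measure_fin.
Qed.

HB.instance Definition _ n := @Measure_isSigmaFinite.Build _ _ _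
  (radial_measure n.+1) (@radial_measure_sigma_finite n).

(* Both sides are measures in A1; on half-lines they agree by scaling. *)
Lemma polar_rectangle n (A1 : set R) (A2 : set (borel_mx R 1 n)) : (0 < n)%N ->
  measurable A1 -> measurable A2 ->
  (leb (eball R n) *
    leb ([set x | A1 (enorm x) /\ A2 (unitv x)] : set (borel_mx R 1 n)) =
   radial_measure n A1 * cone_measure n A2)%E.
Proof.
move=> n0 mA1 mA2; pose V := borel_mx R 1 n.
have mC : measurable ([set x | A2 (unitv x)] : set V).
  by rewrite -[X in measurable X]setTI; exact: measurable_unitv.
have mCB : measurable ([set x | A2 (unitv x)] `&` eball R n : set V).
  by apply: measurableI => //; exact: measurable_eball.
have tf : cone_measure n A2 \is a fin_num by exact: fin_num_measure.
have t0 : 0 <= fine (cone_measure n A2) by exact: fine_ge0.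
have v0 : 0 <= fine (leb (eball R n)) by exact: fine_ge0.
pose m1 := mscale (NngNum v0) (pushm (mrestr (@leb R n) mC) (@measurable_enorm R n)).
pose m2 := mscale (NngNum t0) (radial_measure n).
have m1E B : m1 B = (leb (eball R n) *
    leb ([set x | B (enorm x) /\ A2 (unitv x)] : set V))%E.
  by rewrite /m1 /mscale/= fineK// leb_eball_fin_num.
have m2E B : m2 B = (radial_measure n B * cone_measure n A2)%E.
  by rewrite /m2 /mscale/= fineK// muleC.
rewrite -m1E -m2E; apply: half_line_measure_unique => // a; last first.
  suff : (m1 `]-oo, a]%classic < +oo)%E by [].
  rewrite m1E ltey_eq fin_numM ?leb_eball_fin_num//.
  rewrite ge0_fin_numE ?measure_ge0//; apply: le_lt_trans (radial_measure_fin a n0).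
  apply: le_measure; rewrite ?inE.
  - apply: measurableI => //.
    by rewrite -[X in measurable X]setTI; exact: measurable_enorm.
  - by rewrite -[X in measurable X]setTI; exact: measurable_enorm.
  - by move=> x [].
suff : m1 `]-oo, a]%classic = m2 `]-oo, a]%classic by [].
(* For a > 0 the dilation by a compares the two sides; for a < 0 the sets are empty, and for a = 0
   only the origin can remain, which is null. *)
rewrite m1E m2E; have [a0|a0|<-] := ltgtP 0 a; last 2 first.
- rewrite radial_measure_lt0// mul0e (_ : [set x | _] = set0) ?measure0 ?mule0//.
  apply/seteqP; split => x //= []; rewrite in_itv/= leNgt (lt_le_trans a0)//.
  exact: enorm_ge0.
- rewrite radial_measure_le// expr0n gtn_eqF// !mul0e.
  suff -> : leb ([set x | `]-oo, 0]%classic (enorm x) /\ A2 (unitv x)] : set V) = 0%E.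
    by rewrite mule0.
  apply: (@subset_measure0 _ _ _ (@leb R n) _ [set x | `]-oo, 0]%classic (enorm x)]).
  + apply: measurableI => //.
    by rewrite -[X in measurable X]setTI; exact: measurable_enorm.
  + by rewrite -[X in measurable X]setTI; exact: measurable_enorm.
  + by move=> x [].
  + have := radial_measure_le n0 (lexx 0).
    by rewrite expr0n gtn_eqF// mul0e.
rewrite (radial_measure_le n0 (ltW a0)).
suff -> : leb ([set x | `]-oo, a]%classic (enorm x) /\ A2 (unitv x)] : set V) =
    ((a ^+ n)%:E * cone_measure n A2)%E.
  by rewrite muleCA !muleA.
have -> : cone_measure n A2 = leb ([set x | A2 (unitv x)] `&` eball R n : set V) by [].
rewrite -leb_dilate//.
congr leb; apply/seteqP; split => x; rewrite /mkset /setI/= eballE unitvZ ?invr_gt0//;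
  rewrite in_itv/= enormZ ?invr_ge0 ?(ltW a0)// ler_pdivrMl// mulr1; by case.
Qed.

Lemma prod_EFin (I : Type) (r : seq I) (F : I -> R) :
  (\prod_(i <- r) (F i)%:E)%E = (\prod_(i <- r) F i)%R%:E.
Proof. by rewrite (big_morph EFin (@EFinM R) erefl). Qed.

Lemma prode_pinfty n : (\prod_(j < n.+1) +oo = +oo :> \bar R)%E.
Proof. by elim: n => [|n IH]; rewrite big_ord_recl ?big_ord0 ?mule1// IH mulyy. Qed.

(** Half-lines up to k >= 1 have mass k^(n+1) |B_2^(n+1)| >= k |B_2^(n+1)|, which is unbounded. This
    accounts for directions in which the support function is infinite. *)
Lemma radial_measureT n : radial_measure n.+1 setT = +oo%E.
Proof.
have v0 := leb_eball_gt0 (R := R) n.+1.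
have vf := leb_eball_fin_num (R := R) n.+1.
have [//|rf] := eqVneq (radial_measure n.+1 setT) +oo%E.
have {}rf : radial_measure n.+1 setT \is a fin_num.
  by rewrite ge0_fin_numE ?measure_ge0// ltey.
pose v := fine (leb (eball R n.+1)); pose r := fine (radial_measure n.+1 setT).
have vp : 0 < v by rewrite fine_gt0// v0 ltey_eq vf.
pose k : R := (Num.truncn (r / v)).+1%:R.
have k1 : 1 <= k by rewrite ler1n.
have : (radial_measure n.+1 `]-oo, k]%classic <= radial_measure n.+1 setT)%E.
  by apply: le_measure; rewrite ?inE.
rewrite radial_measure_le ?(le_trans ler01)// -(fineK vf) -(fineK rf) -/v -/r.
rewrite -EFinM lee_fin leNgt => /negP[].
apply: (@lt_le_trans _ _ (k * v)).
  by rewrite -ltr_pdivrMr// truncnS_gt.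
by rewrite ler_pM2r// exprS ler_peMr ?(le_trans ler01)// exprn_ege1.
Qed.

(** With a product of n + 1 factors, t = +oo is included: both sides are then infinite, and
    [polar_volume] needs no splitting of directions. *)
Lemma radial_measure_lee n (t : \bar R) : (0 <= t)%E ->
  (radial_measure n.+1 [set s | (s%:E <= t)%E] =
   leb (eball R n.+1) * \prod_(j < n.+1) t)%E.
Proof.
case: t => [t| |//]; last first.
  move=> _; rewrite prode_pinfty gt0_muley ?leb_eball_gt0//.
  rewrite (_ : [set s | _] = setT); last by apply/seteqP; split => s //= _; exact: leey.
  exact: radial_measureT.
rewrite lee_fin => t0; rewrite prod_EFin prodr_const card_ord muleC -radial_measure_le//.
Qed.

(** Multiplied by |B_2^(n+1)|, the joint law of norm and direction is the product of
    [radial_measure] and [cone_measure], since they agree on rectangles. It is applied to the pairs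
    (s, y) with s <= F y, whose section over y has radial mass |B_2^(n+1)| F(y)^(n+1). *)
Lemma polar_volume n (F : borel_mx R 1 n.+1 -> \bar R) :
  measurable_fun setT F -> (forall x, 0 <= F x)%E ->
  (leb ([set x | ((enorm x)%:E <= F (unitv x))%E] : set (borel_mx R 1 n.+1)) =
   \int[cone_measure n.+1]_x \prod_(j < n.+1) F x)%E.
Proof.
move=> mF F0; pose V := borel_mx R 1 n.+1.
pose v := leb (eball R n.+1); have v0 : (0 < v)%E := leb_eball_gt0 n.+1.
have vf : v \is a fin_num := leb_eball_fin_num n.+1.
have fv0 : 0 <= fine v by exact/fine_ge0/ltW.
have mp : measurable_fun setT (fun x : V => (enorm x, unitv x : V)).
  by apply/measurable_fun_pairP; split; [exact: measurable_enorm|exact: measurable_unitv].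
pose m := mscale (NngNum fv0) (pushm (@leb R n.+1) mp).
have mE B : m B = (v * leb ([set x | B (enorm x, unitv x)] : set V))%E.
  by rewrite /m /mscale/= fineK.
have H := @product_measure_unique _ _ _ _ _ (radial_measure n.+1) (cone_measure n.+1) m.
pose Z : set (R * V) := [set z | (z.1%:E <= F z.2)%E].
have mZ : measurable Z.
  have mB : measurable_fun setT (fun z : R * V => F z.2 - z.1%:E)%E.
    apply: emeasurable_funB; first exact: (measurableT_comp mF).
    by apply/measurable_EFinP; exact: measurable_fst.
  have := emeasurable_fun_c_infty measurableT mB 0%E; rewrite setTI.
  have ZE z : (0 <= F z.2 - z.1%:E)%E = (z.1%:E <= F z.2)%E by rewrite sube_ge0.
  congr (measurable _); apply/seteqP; split => z Zz.
    by change ((z.1%:E <= F z.2)%E); rewrite -ZE.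
  by change ((0 <= F z.2 - z.1%:E)%E); rewrite ZE.
have mprod k : measurable_fun setT (fun x : V => \prod_(j < k) F x)%E.
  elim: k => [|k IH]; first by under eq_fun do rewrite big_ord0; exact: measurable_cst.
  by under eq_fun do rewrite big_ord_recl; apply: emeasurable_funM.
have p0 k x : (0 <= \prod_(j < k) F x)%E by apply: prode_ge0.
have HZ : ((radial_measure n.+1 \x cone_measure n.+1) Z =
    v * leb ([set x | Z (enorm x, unitv x)] : set V))%E.
  rewrite -mE; apply: H => // A B mA mB.
  by rewrite [LHS]mE; exact: polar_rectangle.
apply: (@mule_pinjr _ v) => //=; rewrite muleC -[LHS]HZ.
transitivity (\int[radial_measure n.+1]_s cone_measure n.+1 [set y | Z (s, y)])%E.
  rewrite /product_measure1; apply: eq_integral => s _ /=; congr (cone_measure _ _).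
  by apply/seteqP; split => y; rewrite /xsection/= inE.
rewrite (tonelli_set (radial_measure n.+1) (cone_measure n.+1) mZ).
rewrite muleC -ge0_integralZl; first last.
- exact: ltW.
- by move=> y _; exact: p0.
- exact: mprod.
- exact: measurableT.
by apply: eq_integral => y _; rewrite -radial_measure_lee.
Qed.

End polar.

Arguments cone_measure {R} n.
Arguments radial_measure {R} n.

(** * Support functions, flowers and projections *)

Section support.
Context {R : realType} {n : nat}.
Implicit Types (x y : 'rV[R]_n) (K A : set 'rV[R]_n).

Lemma support_fun_ge K x y : K y -> ((dotp y x)%:E <= support_fun K x)%E.
Proof. by move=> Ky; apply: ereal_sup_ubound; exists y. Qed.

Lemma support_fun_ge0 K x : K 0 -> (0 <= support_fun K x)%E.
Proof. by move=> K0; have := support_fun_ge x K0; rewrite dotp0l. Qed.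

Lemma support_funZ K x a : 0 < a ->
  (support_fun K (a *: x) = a%:E * support_fun K x)%E.
Proof.
have le (b : R) z : 0 < b -> (support_fun K (b *: z) <= b%:E * support_fun K z)%E.
  move=> b0; apply: ge_ereal_sup => _ [y Ky <-].
  by rewrite dotpZr EFinM lee_pmul2l// support_fun_ge.
move=> a0; apply/le_anti; rewrite le//=.
have ai0 : 0 < a^-1 by rewrite invr_gt0.
have := le a^-1 (a *: x) ai0; rewrite scalerA mulVf ?gt_eqF// scale1r.
by rewrite -(lee_pmul2l (x := a%:E))// muleA -EFinM mulfV ?gt_eqF// mul1e.
Qed.

(** Cauchy-Schwarz for unit vectors, read off from 0 <= |y - x|^2. *)
Lemma support_fun_eball x : sphere R n x -> support_fun (eball R n) x = 1%E.
Proof.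
move=> x1; apply/le_anti/andP; split; last first.
  rewrite -[X in (X <= _)%E]/(1%:E) -{1}x1; apply: support_fun_ge.
  by rewrite /eball/= x1.
apply: ge_ereal_sup => _ [y y1 <-]; rewrite lee_fin.
have := dotp_ge0 (y - x); rewrite !(dotpDl, dotpDr, dotpNl, dotpNr) [dotp x y]dotpC.
by move: y1 x1; rewrite /eball /sphere/= => y1 x1; lra.
Qed.

(** A supremum of linear functions is lower semicontinuous: its strict superlevel sets are unions of
    open half-spaces. *)
Lemma measurable_support_fun K :
  measurable_fun setT (support_fun K : borel_mx R 1 n -> \bar R).
Proof.
apply: (measurability _ (measurable_realfun.ErealGenOInfty.measurableE R)).
move=> /= _ [_ [a ->]] <-; rewrite setTI; apply: open_measurable_borel.
rewrite preimage_itvoy (_ : mkset _ = \bigcup_(y in K) [set x | a < dotp y x]).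
  apply: bigcup_open => y _.
  rewrite (_ : mkset _ = (fun x => dotp y x) @^-1` `]a, +oo[); last first.
    by apply/seteqP; split => x /=; rewrite in_itv/= andbT.
  apply: open_comp; last exact: rray_open.
  move=> x _; move: x; pose F r x := \sum_(j <- r) y 0 j * x 0 j.
  suff cF r : continuous (F r) by exact: cF.
  elim: r => [|j r IH].
    rewrite (_ : F [::] = cst 0); first exact: cst_continuous.
    by apply/funext => x; rewrite /F big_nil.
  rewrite (_ : F (j :: r) = fun x => y 0 j * x 0 j + F r x); last first.
    by apply/funext => x; rewrite /F big_cons.
  move=> x; apply: (@continuousD _ _ _ (fun x : 'rV[R]_n => y 0 j * x 0 j));
    last exact: IH.
  by apply: continuousM; [exact: cst_continuous|exact: coord_continuous].
apply/seteqP; split => x /=.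
  by move=> /ereal_sup_gt[_ [y Ky <-]]; rewrite lte_fin => ay; exists y.
by move=> [y Ky ay]; apply: lt_le_trans (support_fun_ge x Ky); rewrite lte_fin.
Qed.

(** By 1-homogeneity, the ray condition |x| <= h_K(x/|x|) defining the flower can be written without
    division, in a form that makes sense at 0. *)
Lemma sqr_le_support_fun K x :
  ((dotp x x)%:E <= support_fun K x)%E = ((enorm x)%:E <= support_fun K (unitv x))%E.
Proof.
have [->|x0] := eqVneq x 0; first by rewrite unitv0 dotp0l enorm0.
have e0 : 0 < enorm x by rewrite enorm_gt0.
have -> : (support_fun K x = (enorm x)%:E * support_fun K (unitv x))%E.
  by rewrite -support_funZ// -enorm_unitvE.
by rewrite -enorm_sqr expr2 EFinM lee_pmul2l.
Qed.

Lemma unitv_sphere x : sphere R n x -> unitv x = x.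
Proof. by rewrite /sphere/unitv/enorm/= => ->; rewrite sqrtr1 invr1 scale1r. Qed.

(** The explicit set meets the specification in [flower], and a star body of E is recovered from its
    radial function, so [xget] can only return it. *)
Lemma flowerE (E : {vspace 'rV[R]_n}) K : K 0 ->
  flower E K = [set x | x \in E /\ ((dotp x x)%:E <= support_fun K x)%E].
Proof.
move=> K0; set A0 := RHS.
have A0P x : A0 x <-> x \in E /\ ((enorm x)%:E <= support_fun K (unitv x))%E.
  by rewrite /A0/= sqr_le_support_fun.
have A00 : A0 0 by split; rewrite ?mem0v// dotp0l support_fun_ge0.
have rayP theta l : dotp theta theta = 1 -> theta \in E -> 0 <= l ->
    A0 (l *: theta) <-> (l%:E <= support_fun K theta)%E.
  move=> t1 tE; rewrite le_eqVlt => /predU1P[<-|l0].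
    by rewrite scale0r; split=> _ //; exact: support_fun_ge0.
  rewrite A0P (enormZ _ (ltW l0)) unitvZ// unitv_sphere// /enorm t1 sqrtr1 mulr1.
  by split=> [[]//|?]; split => //; rewrite memvZ.
have radA0 theta : dotp theta theta = 1 -> theta \in E ->
    radial_fun A0 theta = support_fun K theta.
  move=> t1 tE; apply/le_anti/andP; split.
    by apply: ge_ereal_sup => _ [l [l0 Al] <-]; apply/rayP.
  have radge l : 0 <= l -> (l%:E <= support_fun K theta)%E ->
      (l%:E <= radial_fun A0 theta)%E.
    by move=> l0 lh; apply: ereal_sup_ubound; exists l => //; split => //; exact/rayP.
  have := support_fun_ge0 theta K0; move: radge.
  case: (support_fun K theta) => [r| |//] radge r0; first exact: radge.
  rewrite leye_eq; apply/eqP/eqyP => r r_gt0.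
  by apply: radge; rewrite ?leey// ltW.
have bodyA0 : star_body E A0.
  split.
    split; [by exists 0|by move=> x []|move=> x l /A0P[xE xh] /andP[]].
    rewrite le_eqVlt => /predU1P[<- _|l0 l1]; first by rewrite scale0r.
    apply/A0P; split; first exact: memvZ.
    rewrite unitvZ// (enormZ _ (ltW l0)); apply: le_trans xh.
    by rewrite lee_fin ler_piMl// enorm_ge0.
  move=> theta t1 tE; rewrite radA0// => hoo.
  have h0 := support_fun_ge0 theta K0.
  have hf : support_fun K theta \is a fin_num by rewrite ge0_fin_numE.
  by apply/rayP => //; rewrite ?fineK// fine_ge0.
rewrite /flower; apply: xget_unique; first by split.
move=> A [[[[a Aa] AE Astar] Abody] radA].
have A_0 : A 0 by rewrite -(scale0r a); apply: Astar; rewrite ?lexx ?ler01.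
apply/seteqP; split=> x Ax; have [->//|x0] := eqVneq x 0.
  have xE := AE _ Ax; have Sx := sphere_unitv x0.
  have uE : unitv x \in E by rewrite memvZ.
  apply/A0P; split => //; rewrite -radA//; apply: ereal_sup_ubound.
  by exists (enorm x) => //; split; [exact: enorm_ge0|rewrite -enorm_unitvE].
have [xE xh] := (A0P x).1 Ax; have Sx := sphere_unitv x0.
have uE : unitv x \in E by rewrite memvZ.
have e0 : 0 < enorm x by rewrite enorm_gt0.
(* A point of A at or beyond x on its ray is enough, A being star-shaped. If the radial function is
   finite, the end point lies in A; if it is infinite, some point beyond x does. *)
suff [l xl Al] : exists2 l, enorm x <= l & A (l *: unitv x).
  have l0 : 0 < l := lt_le_trans e0 xl.
  have -> : x = (enorm x / l) *: (l *: unitv x).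
    by rewrite scalerA divfK ?gt_eqF// -enorm_unitvE.
  by apply: Astar => //; rewrite divr_ge0 ?(ltW e0) ?(ltW l0)//= ler_pdivrMr// mul1r.
have [roo|roo] := ltP (radial_fun A (unitv x)) +oo%E.
  have h0 := support_fun_ge0 (unitv x) K0.
  exists (fine (radial_fun A (unitv x))); last exact: Abody.
  by rewrite -lee_fin fineK radA// ge0_fin_numE// -radA.
have : ((enorm x)%:E < radial_fun A (unitv x))%E by apply: lt_le_trans roo; exact: ltry.
by move=> /ereal_sup_gt[_ [l [l0 Al] <-]]; rewrite lte_fin => xl; exists l => //; exact: ltW.
Qed.

End support.

(** * Orthonormal bases and orthogonal projections *)

Section subspaces.
Context {R : realType} {n : nat}.
Implicit Types (x y : 'rV[R]_n) (E : {vspace 'rV[R]_n}).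

(** The number of rows is a parameter rather than [\dim E], so that bases with literally [i.+1] rows
    can be used. *)
Definition orthobasis E k (U : 'M[R]_(k, n)) :=
  U *m U^T = 1%:M /\ forall x, (x \in E) = (x <= U)%MS.

Definition row_vspace k (U : 'M[R]_(k, n)) : {vspace 'rV[R]_n} :=
  limg (linfun (mulmxr U : 'rV[R]_k -> 'rV[R]_n)).

Lemma mem_row_vspace k (U : 'M[R]_(k, n)) x : (x \in row_vspace U) = (x <= U)%MS.
Proof.
apply/memv_imgP/submxP => [[c _ ->]|[c ->]]; first by exists c; rewrite lfunE.
by exists c; rewrite ?memvf// lfunE.
Qed.

Lemma dim_row_vspace k (U : 'M[R]_(k, n)) :
  U *m U^T = 1%:M -> \dim (row_vspace U) = k.
Proof.
move=> UU; rewrite limg_dim_eq ?dimvf /dim/= ?mul1n//.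
apply/eqP; rewrite (eqP (_ : lker _ == 0%VS)) ?capv0//.
apply/lker0P => c c'; rewrite !lfunE/= => /(congr1 (mulmx^~ U^T)).
by rewrite -!mulmxA UU !mulmx1.
Qed.

(** Gram-Schmidt: an orthonormal family of k < dim E vectors of E misses some x in E, whose
    component orthogonal to the family is normalised and added. At k = dim E the span is E. *)
Lemma orthobasis_exists E : exists U : 'M[R]_(\dim E, n), orthobasis E U.
Proof.
pose W k (U : 'M[R]_(k, n)) := row_vspace U.
have WP k (U : 'M[R]_(k, n)) x : (x \in W k U) = (x <= U)%MS := mem_row_vspace U x.
have dimW k (U : 'M[R]_(k, n)) : U *m U^T = 1%:M -> \dim (W k U) = k.
  exact: dim_row_vspace.
have ex k : (k <= \dim E)%N -> exists U : 'M[R]_(k, n),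
    U *m U^T = 1%:M /\ (W k U <= E)%VS.
  elim: k => [_|k IH kE].
    exists 0; split; first by apply/matrixP => -[].
    apply/subvP => x; rewrite WP => /submxP[c ->].
    by rewrite [c]thinmx0 mul0mx mem0v.
  have [U [UU UE]] := IH (ltnW kE).
  have /subvPn[x xE xU] : ~~ (E <= W k U)%VS.
    by apply: contraL kE => /dimvS; rewrite dimW// -leqNgt.
  pose v := x - x *m U^T *m U.
  have vE : v \in E.
    by rewrite memvB//; apply: (subvP UE); rewrite WP submxMl.
  have v0 : v != 0.
    by apply: contraNneq xU => /eqP; rewrite WP subr_eq0 => /eqP ->; exact: submxMl.
  have vU : v *m U^T = 0 by rewrite mulmxBl -!mulmxA UU mulmx1 subrr.
  have uu : unitv v *m (unitv v)^T = 1%:M.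
    by rewrite [LHS]mx11_scalar -dotpE; have := sphere_unitv v0; rewrite /sphere/= => ->.
  have uU : unitv v *m U^T = 0 by rewrite /unitv -scalemxAl vU scaler0.
  exists (col_mx (unitv v) U : 'M[R]_(1 + k, n)); split.
    change (col_mx (unitv v) U *m (col_mx (unitv v) U)^T = 1%:M :> 'M[R]_(1 + k)).
    rewrite tr_col_mx mul_col_row uu UU uU.
    rewrite -[U *m _]trmxK trmx_mul trmxK uU trmx0.
    by rewrite -scalar_mx_block.
  apply/subvP => y; rewrite WP => /submxP[c ->].
  have -> : c *m col_mx (unitv v) U =
      lsubmx (c : 'M[R]_(1, 1 + k)) *m unitv v + rsubmx (c : 'M[R]_(1, 1 + k)) *m U.
    by rewrite -mul_row_col hsubmxK.
  rewrite memvD//; last by apply: (subvP UE); rewrite WP submxMl.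
  by rewrite [lsubmx _]mx11_scalar mul_scalar_mx memvZ// memvZ.
have [U [UU UE]] := ex _ (leqnn _); exists U; split => // x.
have EW : W _ U = E by apply/eqP; rewrite eqEdim UE dimW /=.
by rewrite -WP EW.
Qed.

Lemma onbP E : orthobasis E (onb E).
Proof. by have := xgetPex 0 (orthobasis_exists E); exact. Qed.

Section basis.
Context E k (U : 'M[R]_(k, n)) (EU : orthobasis E U).

(** Two solutions of the specification of [oproj] differ by a vector of E orthogonal to itself. *)
Lemma oprojE x : oproj E x = x *m U^T *m U.
Proof.
have [UU UE] := EU; apply: xget_unique.
  split; first by rewrite UE submxMl.
  move=> z; rewrite UE => /submxP[c ->].
  rewrite [dotp _ _]dotpC dotp_mulmx mulmxBl -(mulmxA _ U) UU mulmx1 subrr.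
  by rewrite dotpC dotp0l.
move=> y [yE ortho]; have pE : x *m U^T *m U \in E by rewrite UE submxMl.
apply/eqP; rewrite -subr_eq0 -dotp_eq0; set p := x *m U^T *m U in pE *.
have yp : y - p \in E by rewrite memvB.
have pO : dotp (x - p) (y - p) = 0.
  move: yp; rewrite UE => /submxP[c ->].
  rewrite dotpC dotp_mulmx mulmxBl /p -(mulmxA _ U) UU mulmx1 subrr.
  by rewrite dotpC dotp0l.
have -> : dotp (y - p) (y - p) = dotp (x - p) (y - p) - dotp (x - y) (y - p).
  rewrite -dotpNl -dotpDl; congr (dotp _ _).
  by rewrite opprB [RHS]addrC addrA subrK.
by rewrite pO ortho// subrr.
Qed.

Lemma proj_matrixE : proj_matrix E = U^T *m U :> 'M[R]_n.
Proof.
apply/matrixP => i j; rewrite mxE oprojE -mulmxA -rowE mxE.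
by [].
Qed.

Lemma orthobasis_rotate Q : orthogonal_mx Q -> orthobasis (rotate Q E) (U *m Q).
Proof.
move=> oQ; have [UU UE] := EU; split.
  by rewrite trmx_mul mulmxA -(mulmxA U) oQ mulmx1.
move=> x; apply/memv_imgP/submxP => [[y yE ->]|[c ->]].
  by move: yE; rewrite UE => /submxP[c ->]; exists c; rewrite lfunE/= mulmxA.
exists (c *m U); first by rewrite UE submxMl.
by rewrite lfunE/= mulmxA.
Qed.

End basis.

End subspaces.

(** * Averages of projections *)

Section averaging.
Context {R : realType}.

Lemma integral_full_set d (T : measurableType d) (m : {measure set T -> \bar R})
    (D : set T) (f : T -> \bar R) : measurable D -> m (~` D) = 0%E ->
  measurable_fun setT f -> (forall x, 0 <= f x)%E ->
  (\int[m]_(x in D) f x = \int[m]_x f x)%E.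
Proof.
move=> mD m0 mf f0; rewrite [RHS](ge0_negligible_integral (N := ~` D))//.
  by rewrite setTD setCK.
exact: measurableC.
Qed.

Lemma leb_ball_rotation n : rotation_invariant (@leb_ball R n).
Proof.
move=> Q oQ A mA; rewrite !leb_ballE.
rewrite -[RHS](leb_rotate oQ); last by apply: measurableI => //; exact: measurable_eball.
by congr leb; apply/seteqP; split => x; rewrite /setI/mkset/= /eball/= dotp_isometry.
Qed.

Lemma leb_ballT n : @leb_ball R n setT = leb (eball R n).
Proof. by rewrite leb_ballE setTI. Qed.

(** A rotation taking the first basis vector to u/|u| reduces to the hyperplane x_0 = 0, whose
    sections along that coordinate are single points. *)
Lemma leb_hyperplane n (u : 'rV[R]_n) : u != 0 ->
  leb ([set x | dotp x u = 0] : set (borel_mx R 1 n)) = 0%E.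
Proof.
case: n u => [u|n u u0]; first by rewrite [u]thinmx0 eqxx.
have Se : sphere R n.+1 (delta_mx 0 0).
  rewrite /sphere/= /dotp (bigD1 ord0)//= mxE eqxx mulr1 big1 ?addr0// => j j0.
  by rewrite mxE (negbTE j0) andbF mulr0.
have [Q oQ Qe] := reflection_sphere Se (sphere_unitv u0).
have mH (v : 'rV[R]_n.+1) : measurable ([set x | dotp x v = 0] : set (borel_mx R 1 n.+1)).
  rewrite -[X in measurable X]setTI (_ : [set x | _] =
    (fun x : borel_mx R 1 n.+1 => dotp x v) @^-1` [set 0])//.
  by apply: measurable_dotp => //; exact: measurable_set1.
rewrite -(leb_rotate oQ)//.
rewrite (_ : [set x | _] = [set x : 'rV_n.+1 | x 0 0 = 0]).
  rewrite /leb/pushm/pushforward [LHS]lebesgue_tupleS integral0_eq// => t _.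
  rewrite (_ : [set s | _] = [set 0]) ?lebesgue_measure_set1//.
  by apply/seteqP; split => s /=; rewrite mxE tnth0.
have xQ (x : 'rV[R]_n.+1) : dotp (x *m Q) u = enorm u * x 0 0.
  rewrite [u in LHS]enorm_unitvE dotpZr -Qe dotp_isometry// /dotp (bigD1 ord0)//=.
  rewrite mxE eqxx mulr1 big1 ?addr0// => j j0.
  by rewrite mxE (negbTE j0) andbF mulr0.
apply/seteqP; split => x /=; rewrite xQ.
  by move=> /eqP; rewrite mulf_eq0 enorm_eq0 (negbTE u0)/= => /eqP.
by move=> ->; rewrite mulr0.
Qed.

(** Having a zero projection forces orthogonality to the first row of U, a null condition. Hence the
    default value [unitv 0] is met only on a null set. *)
Lemma leb_ball_ker n k (U : 'M[R]_(k.+1, n)) : U *m U^T = 1%:M ->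
  forall A : set (borel_mx R 1 n), measurable A ->
  (forall x, A x -> (x : 'rV[R]_n) *m U^T = 0) -> leb_ball A = 0%E.
Proof.
move=> UU A mA AU; rewrite leb_ballE.
have u0 : row 0 U != 0.
  apply/eqP => u0; have := congr1 (fun M : 'M[R]_k.+1 => M 0 0) UU.
  rewrite -[U *m U^T]trmxK trmx_mul trmxK [in LHS]mxE mxE.
  rewrite (eq_bigr (fun=> 0)) ?big1//.
    by rewrite mxE eqxx => /esym/eqP; rewrite oner_eq0.
  move=> j _; have := congr1 (fun M : 'rV[R]_n => M 0 j) u0; rewrite !mxE => ->.
  by rewrite mul0r.
apply: (@subset_measure0 _ _ _ (@leb R n) _ [set x | dotp x (row 0 U) = 0]).
- by apply: measurableI => //; exact: measurable_eball.
- rewrite -[X in measurable X]setTI (_ : [set x | _] =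
    (fun x : borel_mx R 1 n => dotp x (row 0 U)) @^-1` [set 0])//.
  by apply: measurable_dotp => //; exact: measurable_set1.
- move=> x [/AU xU _] /=; have := congr1 (fun M : 'rV[R]_k.+1 => M 0 0) xU.
  by rewrite !mxE => <-; apply: eq_bigr => j _; rewrite !mxE.
- exact: leb_hyperplane.
Qed.

Lemma cone_measure_sphere n : (0 < n)%N -> cone_measure n (~` sphere R n) = 0%E.
Proof.
move=> n0; apply: (@subset_measure0 _ _ _ (@leb R n) _ [set 0]).
- apply: measurableI; last exact: measurable_eball.
  rewrite -[X in measurable X]setTI; apply: measurable_unitv => //.
  by apply: measurableC; exact: measurable_sphere.
- rewrite -[X in measurable X]setTI (_ : [set 0] = @enorm R n @^-1` [set 0]).
    by apply: measurable_enorm => //; exact: measurable_set1.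
  by apply/seteqP; split => x /= => [->|/eqP]; rewrite ?enorm0// enorm_eq0 => /eqP.
- move=> x [/= nS _]; apply: contrapT => /eqP x0; apply: nS; exact: sphere_unitv.
- exact: leb_set0.
Qed.

Lemma cone_measure_rotation n : rotation_invariant (@cone_measure R n).
Proof.
move=> Q oQ A mA; have mu : measurable ([set x | A (unitv x)] : set (borel_mx R 1 n)).
  by rewrite -[X in measurable X]setTI; exact: measurable_unitv.
transitivity (leb_ball ([set x | A (unitv ((x : 'rV[R]_n) *m Q))]
    : set (borel_mx R 1 n))); last exact: (leb_ball_rotation oQ mu).
by congr leb_ball; apply/seteqP; split => x /=; rewrite unitv_isometry.
Qed.

Section frame.
Context n k (U : 'M[R]_(k.+1, n)) (UU : U *m U^T = 1%:M).

Let proj (x : borel_mx R 1 n) : borel_mx R 1 k.+1 := unitv ((x : 'rV[R]_n) *m U^T).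

Let mproj : measurable_fun setT proj.
Proof.
apply: (measurableT_comp (@measurable_unitv R k.+1)).
exact: measurable_mulmx.
Qed.

Let proj_sphere : pushm (@leb_ball R n) mproj (~` sphere R k.+1) = 0%E.
Proof.
apply: (leb_ball_ker UU).
  rewrite -[X in measurable X]setTI; apply: mproj => //.
  by apply: measurableC; exact: measurable_sphere.
move=> x /= nS; apply: contrapT => /eqP x0; apply: nS; exact: sphere_unitv.
Qed.

Let proj_rotation : rotation_invariant (pushm (@leb_ball R n) mproj).
Proof.
(* P extends Q by the identity on the orthogonal complement of the rows of U. *)
move=> Q oQ A mA; pose P := 1%:M + U^T *m (Q - 1%:M) *m U.
(* Applying P and then taking coordinates along U amounts to taking them and then applying Q. *)
have UP : U^T *m Q = P *m U^T.
  rewrite mulmxDl mul1mx -!mulmxA UU mulmx1 mulmxBr mulmx1.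
  by rewrite addrC subrK.
have oP : orthogonal_mx P.
  have PT : P^T = 1%:M + U^T *m (Q^T - 1%:M) *m U.
    by rewrite linearD/= trmx1 !trmx_mul linearB/= trmx1 trmxK mulmxA.
  rewrite /orthogonal_mx PT /P; set D := Q - 1%:M; set D' := Q^T - 1%:M.
  have DD : D' + (D + D *m D') = 0.
    rewrite /D /D' mulmxBl mulmxBr mulmx1 mul1mx oQ.
    by apply/matrixP => i j; rewrite !mxE; ring.
  rewrite mulmxDl mul1mx mulmxDr mulmx1.
  have -> : U^T *m D *m U *m (U^T *m D' *m U) = U^T *m (D *m D') *m U.
    by rewrite !mulmxA -(mulmxA (U^T *m D) U) UU mulmx1.
  by rewrite -addrA -!mulmxDl -!mulmxDr DD mulmx0 mul0mx addr0.
have mA' : measurable ([set x | A (proj x)] : set (borel_mx R 1 n)).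
  by rewrite -[X in measurable X]setTI; exact: mproj.
transitivity (leb_ball ([set x | A (proj ((x : 'rV[R]_n) *m P))]
    : set (borel_mx R 1 n))); last exact: (leb_ball_rotation oP mA').
congr leb_ball; apply/seteqP; split => x /=;
  by rewrite /proj -unitv_isometry// -!mulmxA UP.
Qed.

(** The law of the direction of x U^T, for x in the ball of R^n, has total mass |B_2^n|, and the
    cone measure of R^(k+1) has total mass |B_2^(k+1)|: these are the cross factors of
    uniqueness. *)
Lemma integral_frame (F : borel_mx R 1 k.+1 -> \bar R) :
  measurable_fun setT F -> (forall x, 0 <= F x)%E ->
  (leb (eball R k.+1) * \int[@leb_ball R n]_x F (unitv ((x : 'rV[R]_n) *m U^T)) =
   leb (eball R n) * \int[cone_measure k.+1]_x F x)%E.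
Proof.
move=> mF F0.
have := rotation_invariant_integral proj_sphere (@cone_measure_sphere k.+1 isT)
  proj_rotation (@cone_measure_rotation k.+1) mF F0.
rewrite integral_pushm// preimage_setT => h.
by rewrite -[X in (X * _ = _)%E]leb_ballT -[X in (_ = X * _)%E]leb_ballT.
Qed.

(** Polar coordinates in R^(k+1) for F(y) = h_K(y U), the support function read in the basis U,
    followed by [integral_frame] for F^(k+1). *)
Lemma flower_volume (K : set 'rV[R]_n) : K 0 ->
  (leb (eball R n) * leb ([set c | ((dotp c c)%:E <= support_fun K ((c : 'rV[R]_k.+1) *m U))%E]
     : set (borel_mx R 1 k.+1)) =
   leb (eball R k.+1) *
   \int[@leb_ball R n]_x \prod_(j < k.+1) support_fun K (unitv ((x : 'rV[R]_n) *m U^T *m U)))%E.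
Proof.
move=> K0; pose F (y : borel_mx R 1 k.+1) := support_fun K ((y : 'rV[R]_k.+1) *m U).
have mF : measurable_fun setT F.
  apply: (measurableT_comp (@measurable_support_fun R n K)).
  exact: measurable_mulmx.
have F0 y : (0 <= F y)%E by exact: support_fun_ge0.
have mFk m : measurable_fun setT (fun y => \prod_(j < m) F y)%E.
  elim: m => [|m IH].
    by under eq_fun do rewrite big_ord0; exact: measurable_cst.
  by under eq_fun do rewrite big_ord_recl; apply: emeasurable_funM.
have Fk0 m y : (0 <= \prod_(j < m) F y)%E by exact: prode_ge0.
transitivity (leb (eball R n) * \int[cone_measure k.+1]_y \prod_(j < k.+1) F y)%E.
  congr (_ * _)%E; rewrite -(polar_volume mF F0); congr leb.
  apply/seteqP; split => c /=; rewrite /F -unitv_isometry// -(enorm_isometry _ UU);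
    by rewrite -sqr_le_support_fun dotp_isometry.
rewrite -(integral_frame (mFk k.+1) (Fk0 k.+1)); congr (_ * _)%E.
by apply: eq_integral => x _; rewrite /F -unitv_isometry.
Qed.

End frame.

End averaging.

(** * Random subspaces and the law of the projected direction *)

Section grassmannian_measures.
Context {R : realType} {n : nat}.

Lemma measurable_proj_matrix :
  measurable_fun setT (@proj_matrix R n : subspaces R n -> borel_mx R n n).
Proof. by move=> _ B mB; exists B. Qed.

Lemma oproj_matrixE (E : subspaces R n) (x : 'rV[R]_n) :
  oproj E x = x *m (proj_matrix E : 'M[R]_n).
Proof. by rewrite (proj_matrixE (onbP E)) (oprojE (onbP E)) mulmxA. Qed.

Lemma oproj_rotate (Q : 'M[R]_n) (E : subspaces R n) (x : 'rV[R]_n) :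
  orthogonal_mx Q -> oproj (rotate Q E) (x *m Q) = oproj E x *m Q.
Proof.
move=> oQ; rewrite (oprojE (orthobasis_rotate (onbP E) oQ)) (oprojE (onbP E)).
by rewrite trmx_mul !mulmxA -(mulmxA x) oQ mulmx1.
Qed.

(** On projection matrices, rotating a subspace is the conjugation P |-> Q^T P Q. *)
Lemma measurable_rotate (Q : 'M[R]_n) : orthogonal_mx Q ->
  measurable_fun setT (@rotate R n Q : subspaces R n -> subspaces R n).
Proof.
move=> oQ _ _ [B mB <-]; rewrite !setTI.
pose f (E : subspaces R n) : borel_mx R n n :=
  (Q^T *m ((proj_matrix E : 'M[R]_n) *m Q)).
have mf : measurable_fun setT f.
  apply: measurable_mulmx => //; apply: measurable_mulmx => //.
  exact: measurable_proj_matrix.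
rewrite (_ : _ @^-1` _ = f @^-1` B); first by rewrite -[X in measurable X]setTI; exact: mf.
rewrite -comp_preimage; congr (_ @^-1` B); apply/funext => E /=.
rewrite /f (proj_matrixE (orthobasis_rotate (onbP E) oQ)) (proj_matrixE (onbP E)).
by rewrite trmx_mul !mulmxA.
Qed.

(** The dimension is the trace of the projection matrix, a measurable function of E. *)
Lemma measurable_grassmannian i : measurable (grassmannian R n i).
Proof.
pose f (E : subspaces R n) : R := \tr (proj_matrix E : 'M[R]_n).
have mf : measurable_fun setT f.
  apply: measurable_sum => j.
  by have /measurable_matrixP := measurable_proj_matrix; exact.
rewrite (_ : grassmannian R n i = f @^-1` [set i%:R]).
  by rewrite -[X in measurable X]setTI; apply: mf => //; exact: measurable_set1.
have fE E : f E = (\dim E)%:R.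
  by rewrite /f (proj_matrixE (onbP E)) mxtrace_mulC (onbP E).1 mxtrace1.
apply/seteqP; split => E; rewrite /grassmannian/= fE; first by move=> ->.
by move/eqP; rewrite eqr_nat => /eqP.
Qed.

Lemma measurable_unitv_oproj : measurable_fun setT
  (fun p : subspaces R n * borel_mx R 1 n =>
    unitv (oproj (p.1 : {vspace 'rV[R]_n}) p.2) : borel_mx R 1 n).
Proof.
under eq_fun do rewrite oproj_matrixE.
apply: (measurableT_comp (@measurable_unitv R n)).
apply: (@measurable_mulmx R _ (subspaces R n * borel_mx R 1 n)%type) => //.
exact: (measurableT_comp measurable_proj_matrix).
Qed.

Variable mu : probability (subspaces R n) R.

Definition random_projection : set (borel_mx R 1 n) -> \bar R :=
  pushm (product_measure1 mu (@leb_ball R n)) measurable_unitv_oproj.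

HB.instance Definition _ := Measure.on random_projection.

Lemma random_projectionE (A : set (borel_mx R 1 n)) :
  (random_projection A =
   \int[mu]_E leb_ball [set x | A (unitv (oproj (E : {vspace 'rV[R]_n}) x))])%E.
Proof.
rewrite /random_projection/pushm/pushforward/product_measure1.
apply: eq_integral => E _ /=; congr leb_ball.
by apply/seteqP; split => x; rewrite /xsection/= inE.
Qed.

Lemma random_projectionT : random_projection setT = leb (eball R n).
Proof.
rewrite random_projectionE -leb_ballT.
transitivity (\int[mu]_(E in setT) cst (@leb_ball R n setT) E)%E.
  by apply: eq_integral => E _.
by rewrite integral_cst// [X in (_ * X)%E](_ : _ = 1%E) ?mule1//; exact: probability_setT.
Qed.

Let random_projection_fin : fin_num_fun random_projection.
Proof.
move=> A mA; rewrite ge0_fin_numE ?measure_ge0//.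
apply: (@le_lt_trans _ _ (random_projection setT)).
  by apply: le_measure; rewrite ?inE.
by rewrite random_projectionT; exact: leb_eball_fin.
Qed.

HB.instance Definition _ :=
  Measure_isFinite.Build _ _ _ random_projection random_projection_fin.

Lemma integral_random_projection (f : borel_mx R 1 n -> \bar R) :
  measurable_fun setT f -> (forall x, 0 <= f x)%E ->
  (\int[random_projection]_x f x =
   \int[mu]_E \int[@leb_ball R n]_x f (unitv (oproj (E : {vspace 'rV[R]_n}) x)))%E.
Proof.
move=> mf f0; rewrite integral_pushm//= preimage_setT.
pose g (p : subspaces R n * borel_mx R 1 n) :=
  f (unitv (oproj (p.1 : {vspace 'rV[R]_n}) p.2)).
have mg : measurable_fun setT g := measurableT_comp mf measurable_unitv_oproj.
exact: (@fubini_tonelli1 _ _ _ _ R mu (@leb_ball R n) g mg (fun p => f0 _)).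
Qed.

Lemma measurable_integral_oproj (f : borel_mx R 1 n -> \bar R) :
  measurable_fun setT f -> (forall x, 0 <= f x)%E ->
  measurable_fun setT (fun E : subspaces R n =>
    \int[@leb_ball R n]_x f (unitv (oproj (E : {vspace 'rV[R]_n}) x)))%E.
Proof.
move=> mf f0; pose g (p : subspaces R n * borel_mx R 1 n) :=
  f (unitv (oproj (p.1 : {vspace 'rV[R]_n}) p.2)).
have mg : measurable_fun setT g := measurableT_comp mf measurable_unitv_oproj.
exact: (@measurable_fun_fubini_tonelli_F _ _ _ _ R (@leb_ball R n) g mg (fun p => f0 _)).
Qed.

Lemma measurable_leb_ball_oproj (A : set (borel_mx R 1 n)) : measurable A ->
  measurable_fun setT (fun E : subspaces R n =>
    leb_ball [set x | A (unitv (oproj (E : {vspace 'rV[R]_n}) x))]).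
Proof.
move=> mA.
have mA' : measurable ((fun p : subspaces R n * borel_mx R 1 n =>
    unitv (oproj (p.1 : {vspace 'rV[R]_n}) p.2) : borel_mx R 1 n) @^-1` A).
  by rewrite -[X in measurable X]setTI; exact: measurable_unitv_oproj.
have := measurable_fun_xsection (@leb_ball R n) mA'; congr (measurable_fun _ _).
apply/funext => E /=; congr leb_ball.
by apply/seteqP; split => x; rewrite /xsection/= inE.
Qed.

Lemma measurable_oproj_section (A : set (borel_mx R 1 n)) (E : subspaces R n) :
  measurable A ->
  measurable ([set x | A (unitv (oproj (E : {vspace 'rV[R]_n}) x))]
    : set (borel_mx R 1 n)).
Proof.
move=> mA; under eq_set do rewrite oproj_matrixE.
rewrite -[X in measurable X]setTI.
apply: (measurableT_comp (@measurable_unitv R n) (@measurable_mulmx R _ _ _ _ _ _ _ _ _)) => //.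
Qed.

Section haar.
Variable i : nat.
Hypothesis haar : haar_grassmannian i.+1 mu.

Lemma haar_carried : mu (~` grassmannian R n i.+1) = 0%E.
Proof.
have [mu1 _] := haar.
rewrite probability_setC; last exact: measurable_grassmannian.
by rewrite [X in (1 - X)%E]mu1 subee.
Qed.

(** Almost every E has dimension i + 1 > 0, and for such E almost every x has a nonzero
    projection. *)
Lemma random_projection_sphere : random_projection (~` sphere R n) = 0%E.
Proof.
have mS : measurable (~` sphere R n : set (borel_mx R 1 n)).
  by apply: measurableC; exact: measurable_sphere.
rewrite random_projectionE -(integral_full_set _ haar_carried)//; last 2 first.
- exact: measurable_grassmannian.
- exact: measurable_leb_ball_oproj.
apply: integral0_eq => E Ei.
have [U EU] : exists U : 'M[R]_(i.+1, n), orthobasis E U.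
  by move: Ei (orthobasis_exists E); rewrite /grassmannian/= => ->.
apply: (leb_ball_ker EU.1); first exact: measurable_oproj_section.
move=> x /= nS; have Ex0 : oproj (E : {vspace 'rV[R]_n}) x = 0.
  by apply: contrapT => /eqP x0; apply: nS; exact: sphere_unitv.
move: Ex0; rewrite (oprojE EU) => /(congr1 (mulmx^~ U^T)).
by rewrite -mulmxA EU.1 mulmx1 mul0mx.
Qed.

(** Projection commutes with rotating both x and E, so the invariance of the ball absorbs the
    rotation of x and that of [mu] the rotation of E. *)
Lemma random_projection_rotation : rotation_invariant random_projection.
Proof.
move=> Q oQ A mA; have [_ muQ] := haar; rewrite !random_projectionE.
pose g (E : subspaces R n) :=
  leb_ball [set x | A (unitv (oproj (E : {vspace 'rV[R]_n}) x))].
have mg : measurable_fun setT g := measurable_leb_ball_oproj mA.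
have g0 E : (0 <= g E)%E by exact: measure_ge0.
transitivity (\int[mu]_E g (rotate Q E))%E.
  apply: eq_integral => E _; rewrite /g.
  rewrite -(leb_ball_rotation oQ (measurable_oproj_section (rotate Q E) mA)).
  congr leb_ball; apply/seteqP; split => x /=;
    by rewrite oproj_rotate// unitv_isometry.
transitivity (\int[pushm mu (measurable_rotate oQ)]_E g E)%E.
  by rewrite integral_pushm.
by apply: eq_measure_integral => B mB _; exact: muQ.
Qed.

End haar.

End grassmannian_measures.

(** * Flowers of projections and conclusion *)

Lemma volume_in_flower (R : realType) (n : nat) (K : set 'rV[R]_n)
    (E : {vspace 'rV[R]_n}) : K 0 ->
  volume_in E (flower E (oproj E @` K)) =
  leb ([set c | ((dotp c c)%:E <= support_fun K ((c : 'rV[R]_(\dim E)) *m onb E))%E]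
    : set (borel_mx R 1 (\dim E))).
Proof.
move=> K0; have [UU UE] := onbP E.
rewrite /volume_in volumeE flowerE; last first.
  by exists 0 => //; rewrite (oprojE (onbP E)) !mul0mx.
congr leb; apply/seteqP.
(* For a vector of E, pairing with y or with its projection on E gives the same value, so K and its
   projection have the same support function on E. *)
have supE c : support_fun (oproj E @` K) (c *m onb E) = support_fun K (c *m onb E).
  rewrite /support_fun image_comp; congr ereal_sup; apply: eq_imagel => y _ /=.
  by rewrite (oprojE (onbP E)) dotp_isometry// dotp_mulmx trmxK.
split => c /=; rewrite supE dotp_isometry//; first by case.
by split => //; rewrite UE submxMl.
Qed.

(** In dimension 0 the frame argument has no sphere to work on; there the flower is the single
    point, of measure 1, and the empty product is 1. *)
Lemma flower_volume_any (R : realType) (n m : nat) (U : 'M[R]_(m, n)) (K : set 'rV[R]_n) :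
  K 0 -> U *m U^T = 1%:M ->
  (leb (eball R n) * leb ([set c | ((dotp c c)%:E <= support_fun K ((c : 'rV[R]_m) *m U))%E]
     : set (borel_mx R 1 m)) =
   leb (eball R m) *
   \int[@leb_ball R n]_x \prod_(j < m) support_fun K (unitv ((x : 'rV[R]_n) *m U^T *m U)))%E.
Proof.
move=> K0; case: m U => [|m] U UU; last exact: flower_volume.
have T1 : leb ([set: 'rV[R]_0] : set (borel_mx R 1 0)) = 1%E by exact: diracT.
rewrite [integral _ _ _](_ : _ = leb (eball R n)); last first.
  rewrite (eq_integral (cst 1%E)); last by move=> x _; rewrite big_ord0.
  by rewrite integral_cst// mul1e; exact: leb_ballT.
have dot0 (c : 'rV[R]_0) : dotp c c = 0 by rewrite /dotp big_ord0.
rewrite (_ : [set c | _] = setT); last first.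
  by apply/seteqP; split => c // _ /=; rewrite dot0 support_fun_ge0.
rewrite T1 (_ : eball R 0 = setT) ?T1 ?mul1e ?mule1//.
by apply/seteqP; split => c // _; rewrite /eball/= dot0 ler01.
Qed.

Theorem theorem51 (R : realType) (n i : nat)
    (sigma : probability (borel_mx R 1 n) R)
    (mu : probability (subspaces R n) R)
    (K : set 'rV[R]_n) :
  uniform_sphere sigma ->
  haar_grassmannian i mu ->
  convex_body K ->
  (i <= n)%N ->
  flower_quermassintegral sigma (n - i) K =
    (volume (eball R n) / volume (eball R i) *
     \int[mu]_(E in grassmannian R n i)
       volume_in E (flower E (oproj E @` K)))%E.
Proof.
move=> [sigma1 sigmaQ] haar [_ _ K0] i_n; rewrite !volumeE.
have sigmaS : sigma (~` sphere R n) = 0%E.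
  rewrite probability_setC; last exact: measurable_sphere.
  by rewrite [X in (1 - X)%E]sigma1 subee.
pose f (x : borel_mx R 1 n) := (\prod_(j < i) support_fun K x)%E.
have mf : measurable_fun setT f.
  rewrite /f; elim: (i) => [|m IH].
    by under eq_fun do rewrite big_ord0; exact: measurable_cst.
  under eq_fun do rewrite big_ord_recl; apply: emeasurable_funM => //.
  exact: measurable_support_fun.
have f0 x : (0 <= f x)%E by apply: prode_ge0 => j _; exact: support_fun_ge0.
have vn0 : (0 < leb (eball R n))%E := leb_eball_gt0 n.
have vi0 : (0 < leb (eball R i))%E := leb_eball_gt0 i.
have vnf := leb_eball_fin_num (R := R) n.
have vif := leb_eball_fin_num (R := R) i.
(* On the sphere the support function of the ball is 1, so only n - (n - i) = i factors remain. *)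
have -> : (flower_quermassintegral sigma (n - i) K =
    leb (eball R n) * \int[sigma]_x f x)%E.
  rewrite /flower_quermassintegral /flower_mixed_volume volumeE; congr (_ * _)%E.
  rewrite -(integral_full_set _ sigmaS mf f0); last exact: measurable_sphere.
  apply: eq_integral => x /set_mem Sx; rewrite subKn//.
  rewrite /f (big_ord_widen n (fun=> support_fun K x))// [RHS]big_mkcond.
  by apply: eq_bigr => j _; case: ifP => // _; rewrite support_fun_eball.
have volE E : grassmannian R n i E ->
  (leb (eball R n) * volume_in (E : {vspace 'rV[R]_n}) (flower E (oproj E @` K)) =
   leb (eball R i) * \int[@leb_ball R n]_x f (unitv (oproj (E : {vspace 'rV[R]_n}) x)))%E.
  move=> Ei; rewrite volume_in_flower//.
  have projE x : oproj (E : {vspace 'rV[R]_n}) x = x *m (onb E)^T *m onb E.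
    exact: (oprojE (onbP E)).
  under [in RHS]eq_integral do rewrite projE.
  (* The basis is generalised before its type is rewritten along [\dim E = i]. *)
  have [UU _] := onbP E; move: (onb E) UU; rewrite [\dim _](Ei : \dim E = i) => U UU.
  exact: flower_volume_any.
pose phi (E : subspaces R n) :=
  (\int[@leb_ball R n]_x f (unitv (oproj (E : {vspace 'rV[R]_n}) x)))%E.
have mphi : measurable_fun setT phi by exact: measurable_integral_oproj.
have phi0 E : (0 <= phi E)%E by apply: integral_ge0 => x _; exact: f0.
have vnV : (leb (eball R n) * (leb (eball R n))^-1 = 1)%E.
  by rewrite muleC mulVe// gt_eqF.
(* A pointwise replacement on G(n,i): the integrand built on the chosen basis gives way to [phi],
   whose measurability in E comes from Tonelli. *)
have -> : (\int[mu]_(E in grassmannian R n i)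
    volume_in (E : {vspace 'rV[R]_n}) (flower E (oproj E @` K)) =
    \int[mu]_(E in grassmannian R n i) (leb (eball R i) / leb (eball R n) * phi E))%E.
  apply: eq_integral => E /set_mem Ei.
  by rewrite muleAC -(volE _ Ei) muleAC vnV mul1e.
have c0 : (0 <= leb (eball R i) / leb (eball R n))%E.
  by rewrite mule_ge0 ?inve_ge0 ?measure_ge0.
rewrite ge0_integralZl//; last 2 first.
- exact: measurable_grassmannian.
- exact: measurable_funTS.
have muG : mu (~` grassmannian R n i) = 0%E.
  have [mu1 _] := haar; rewrite probability_setC; last exact: measurable_grassmannian.
  by rewrite [X in (1 - X)%E]mu1 subee.
rewrite (integral_full_set _ muG mphi phi0); last exact: measurable_grassmannian.
rewrite -(integral_random_projection mu mf f0).
(* The factors |B_2^n|/|B_2^i| and |B_2^i|/|B_2^n| cancel, leaving the comparison of the averaged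
   law with |B_2^n| times [sigma]. *)
suff -> : (\int[random_projection mu]_x f x = leb (eball R n) * \int[sigma]_x f x)%E.
  rewrite !muleA; congr (_ * _)%E.
  rewrite -(muleA (leb (eball R n))) mulVe ?gt_eqF// mule1.
  by rewrite -muleA mulVe ?gt_eqF// mule1.
(* For i = 0 all projections vanish and the law is not carried by the sphere, but f is constantly 1
   and only total masses matter. *)
case: (posnP i) => [i0|i_gt0].
  have f1 : f = cst 1%E by apply/funext => x; rewrite /f i0 big_ord0.
  have -> : (\int[random_projection mu]_x f x = 1 * random_projection mu setT)%E.
    by rewrite f1 integral_cst.
  have -> : (\int[sigma]_x f x = 1 * sigma setT)%E by rewrite f1 integral_cst.
  by rewrite random_projectionT probability_setT mul1e !mule1.
have haarS : haar_grassmannian i.-1.+1 mu by rewrite prednK.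
have s1 : sigma setT = 1%E := probability_setT sigma.
rewrite -(random_projectionT mu) -[LHS]mul1e -s1.
exact: (rotation_invariant_integral (random_projection_sphere haarS) sigmaS
  (random_projection_rotation haarS) sigmaQ mf f0).
Qed.
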